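(* Let $K$ be a number field, let $n\ge 1$ be an integer and let $c>0$. There is a constant $C>0$ depending only on $K$, $n$ and $c$ such that the following holds for every real $H\ge 2$. Let $A_1,A_2\in \mathrm{GL}_n(K)$ be two diagonalizable matrices with $\mathcal{H}(A_i)\le cH$ for $i\in\{1,2\}$, and assume that there are integers $k_1,k_2$ with $k_1k_2\neq 0$ such that $$A_1^{k_1}=A_2^{k_2}.$$ Then there are integers $k_1,k_2$ with $k_1k_2\ne 0$ and $|k_1|,|k_2|\le C\log H$ such that $A_1^{k_1}=A_2^{k_2}$ holds.
   Context: For a matrix $A=(a_{ij})$ with algebraic entries, $\mathcal{H}(A)$ denotes the (absolute) multiplicative Weil height of $A$ viewed as a point of projective space via $(1:a_{11}:a_{12}:\cdots:a_{nn})$. ''Diagonalizable'' means diagonalizable over an algebraic closure of $K$. *)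

(* Defs.v *)
From HB Require Import structures.
From mathcomp Require Import all_boot all_order all_algebra all_field.
From mathcomp Require Import finmap.
From mathcomp Require Import boolp classical_sets functions cardinality fsbigop.
From mathcomp Require Import reals exp.
From mathcomp Require Import complex.

Set Implicit Arguments.
Unset Strict Implicit.
Unset Printing Implicit Defensive.

Import Order.TTheory GRing.Theory Num.Theory.

Local Open Scope classical_set_scope.
Local Open Scope ring_scope.

(* A number field is a finite extension of the rationals, i.e. an element of
   fieldExtType rat; its degree over rat is \dim {:K}. *)

Section Height.
Variables (R : realType) (K : fieldExtType rat).

Definition complex_embeddings : set (K -> R[i]) :=
  range (fun s : {rmorphism K -> R[i]} => s : K -> R[i]).

(* For a non-archimedean absolute value v, the elements of the quotient of the
   valuation ring [v x <= 1] by its maximal ideal [v x < 1], as cosets. *)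
Definition residue_field (v : K -> R) : set (set K) :=
  [set [set y | v (y - x) < 1] | x in [set x | v x <= 1]].

Definition residue_card (v : K -> R) : nat := #|` fset_set (residue_field v)|.

(* The finite places of K, each represented by its normalized absolute value
   |x|_v = q_v ^ (- ord_v x), q_v being the cardinality of the residue field;
   equivalently |.|_v restricts on rat to the [K_v : Q_p]-th power of the
   standard p-adic absolute value. *)
Definition finite_places : set (K -> R) :=
  [set v | [/\ forall x, v x = 0 <-> x = 0,
               forall x y, v (x * y) = v x * v y,
               forall x y, v (x + y) <= Num.max (v x) (v y),
               finite_set (residue_field v)
             & [set v x | x in [set x | x != 0]] =
               range (fun k : int => (residue_card v)%:R ^ k)]].

Section Projective.
Variables (m : nat) (x : 'rV[K]_m).

Definition coord_max (v : K -> R) : R := \big[Num.max/0]_(j < m) v (x 0 j).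

(* The absolute multiplicative Weil height of the point of projective space
   with homogeneous coordinates x != 0.  A pair of conjugate embeddings
   represents one complex place, of local degree 2, so the product over all
   embeddings accounts for the local degrees at infinity.  All but finitely
   many factors of the second product are 1. *)
Definition weil_height : R :=
  ((\big[*%R/1]_(s \in complex_embeddings)
      coord_max (@ComplexField.Normc.normc R \o s)) *
   (\big[*%R/1]_(v \in finite_places) coord_max v)) `^ (\dim {:K})%:R^-1.

End Projective.

(* The height of the point (1 : a_11 : a_12 : ... : a_nn). *)
Definition mx_height (n : nat) (A : 'M[K]_n) : R :=
  weil_height (row_mx (1%:M : 'rV_1) (mxvec A)).

End Height.

(* Any embedding K -> algC makes algC an algebraic closure of K. *)
Definition diagonalizable_over_closure (K : fieldExtType rat) (n : nat)
    (A : 'M[K]_n) : Prop :=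
  exists iota : {rmorphism K -> algC}, diagonalizable (map_mx iota A).

(* Main.v *)
From HB Require Import structures.
Require Import Defs.
From mathcomp Require Import all_boot all_order all_algebra all_field.
From mathcomp Require Import finmap.
From mathcomp Require Import boolp classical_sets cardinality fsbigop.
From mathcomp Require Import reals exp.
From mathcomp Require Import complex.
From mathcomp Require Import ring.

(** The equality [A1 ^ k1 = A2 ^ k2] of powers of diagonalizable matrices is a
    finite set of relations [lam ^ k1 = mu ^ k2] between eigenvalues of [A1] and
    of [A2] ([power_relation_eigenvalues]). Each such pair generates an extension
    of [K] of bounded degree, so the roots of unity it contains have order
    dividing a constant [M] ([torsion_exponent]). If all eigenvalues are roots
    of unity, the exponents [M], [M] work. Otherwise let [a / b] be [k1 / k2] in
    lowest terms. For every pair, [lam ^ a / mu ^ b] is a root of unity, so that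
    the exponents [a M], [b M] work, and it remains to bound [a] and [b] by a
    multiple of [ln H].

    Take a pair where [lam] is not a root of unity. Since [a] and [b] are coprime,
    [lam] is, up to a root of unity, the [b]-th power of some [gam] in
    [K(lam, mu)], and [gam] is not a root of unity ([eigenvalue_pairs]). Thus the
    logarithmic height of [lam], which is bounded by a multiple of [ln H], is [b]
    times that of [gam], which is bounded below. Concretely, it is
    enough to compare [lam] and [gam] at one absolute value where [gam] is large:
    - if [gam] is an algebraic integer, a quantitative form of Kronecker's theorem
      ([kronecker_gap]) gives a conjugate of absolute value at least [1 + eps],
      where [eps] depends only on the degree ([large_conjugate]);
    - otherwise a valuation ring that omits [gam], obtained from Zorn's lemma
      ([nonintegral_valuation_ring]), induces a finite place of [K]
      ([place_of_valuation_ring]), and a power of [gam] of bounded exponent has,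
      up to a unit, a value at least 2 there ([nonintegral_bound]).
    At either absolute value, [lam] is controlled by the entries of [A1], and these
    by the height of [A1] ([mx_height_embedding], [mx_height_place]). For this
    last step the products defining the height have to be finite: an element of
    [K] has finitely many poles ([finite_poles]), because there are at most
    [\dim {:K}] places above each prime ([card_places_above]). *)

Set Implicit Arguments.
Unset Strict Implicit.
Unset Printing Implicit Defensive.

Import Order.TTheory GRing.Theory Num.Theory.

Local Open Scope classical_set_scope.
Local Open Scope ring_scope.

(** * Valuation rings as maximal subrings *)

Lemma values_collide (T : eqType) (y : nat -> T) (s : seq T) :
  (forall k, y k \in s) -> exists i j, (i < j)%N /\ y i = y j.
Proof.
move=> ys; have [n yn] : exists n, ~~ uniq [seq y i | i <- iota 0 n].
  exists (size s).+1; apply/negP => u.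
  have := @uniq_leq_size _ _ s u; rewrite size_map size_iota ltnn.
  suff h : {subset [seq y i | i <- iota 0 (size s).+1] <= s} by move=> /(_ h).
  by move=> _ /mapP[k _ ->].
have [i [j [ij]]] := uniqPn (y 0%N) yn; rewrite size_map size_iota => jn.
rewrite !(nth_map 0%N) ?size_iota ?(ltn_trans ij)// !nth_iota ?(ltn_trans ij)//.
by exists i, j.
Qed.

Section SubringTheory.
Variables (E : fieldType) (V : set E).

Definition subring : Prop :=
  [/\ V 1, forall x y, V x -> V y -> V (x - y)
    & forall x y, V x -> V y -> V (x * y)].

Hypothesis hV : subring.

Lemma subring1 : V 1. Proof. by case: hV. Qed.
Lemma subringB x y : V x -> V y -> V (x - y).
Proof. by case: hV => _ + _; apply. Qed.
Lemma subringM x y : V x -> V y -> V (x * y).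
Proof. by case: hV => _ _; apply. Qed.
Lemma subring0 : V 0. Proof. by rewrite -(subrr 1); apply: subringB subring1 subring1. Qed.
Lemma subringN x : V x -> V (- x).
Proof. by rewrite -sub0r; apply: subringB subring0. Qed.
Lemma subringD x y : V x -> V y -> V (x + y).
Proof. by move=> Vx Vy; rewrite -(opprK y); apply/subringB/subringN. Qed.
Lemma subring_sum I (r : seq I) (P : pred I) (F : I -> E) :
  (forall i, P i -> V (F i)) -> V (\sum_(i <- r | P i) F i).
Proof. by move=> h; apply: big_ind; [exact: subring0|exact: subringD|]. Qed.
Lemma subringX x n : V x -> V (x ^+ n).
Proof.
by move=> Vx; elim: n => [|n ih]; [exact: subring1|rewrite exprS; apply: subringM].
Qed.
Lemma subring_int (k : int) : V k%:~R.
Proof.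
have nat_in n : V n%:R.
  by elim: n => [|n ih]; [exact: subring0|rewrite -natr1; apply: subringD ih subring1].
by case: k => n; [exact: nat_in|rewrite NegzE mulrNz; apply/subringN/nat_in].
Qed.

End SubringTheory.

Section MaximalSubring.
Variables (E : fieldType) (A : set E) (x : E).
Hypotheses (hA : subring A) (Ay : A x^-1) (nAx : ~ A x).
Hypothesis maxA : forall B, subring B -> A `<=` B -> ~ B x -> B `<=` A.

Let x0 : x != 0.
Proof. by apply/eqP => x0; apply: nAx; rewrite x0; apply: subring0. Qed.

(** This is [A[z]]. *)
Let adj (z : E) : set E :=
  [set w | exists2 p : {poly E}, (forall i, A p`_i) & p.[z] = w].

Let adj_subring z : subring (adj z).
Proof.
split.
- exists 1; last by rewrite hornerC.
  by move=> i; rewrite coef1; case: (i == _); [exact: subring1|exact: subring0].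
- move=> _ _ [p Ap <-] [q Aq <-]; exists (p - q); last by rewrite !hornerE.
  by move=> i; rewrite coefB; apply: subringB.
- move=> _ _ [p Ap <-] [q Aq <-]; exists (p * q); last by rewrite !hornerE.
  by move=> i; rewrite coefM; apply: subring_sum => // j _; apply: subringM.
Qed.

Let sub_adj z : A `<=` adj z.
Proof.
move=> a Aa; exists a%:P; last by rewrite hornerC.
by move=> i; rewrite coefC; case: (i == _) => //; exact: subring0.
Qed.

Let mem_adj z : adj z z.
Proof.
exists 'X; last by rewrite hornerX.
by move=> i; rewrite coefX; case: (i == _); [exact: subring1|exact: subring0].
Qed.

Let adjP z : ~ A z -> adj z x.
Proof.
move=> nAz; apply: contrapT => nx; apply: nAz.
by apply: (maxA (adj_subring z) (@sub_adj z) nx); apply: mem_adj.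
Qed.

(** An inverse of [1 - x^-1 b] that lay outside [A] would satisfy
    [x = q((1 - x^-1 b)^-1)]; clearing the powers of [1 - x^-1 b], which are
    congruent to 1 modulo [x^-1 A], would put [x] itself in [A]. *)
Let unit_1B b : A b -> 1 - x^-1 * b != 0 /\ A (1 - x^-1 * b)^-1.
Proof.
move=> Ab; set w := 1 - x^-1 * b.
have w0 : w != 0.
  apply/eqP => /eqP; rewrite subr_eq0 => /eqP h; apply: nAx.
  by rewrite -[x]mulr1 h mulVKf.
split=> //; apply: contrapT => /adjP[p Ap hp]; apply: nAx.
have wA : A w by apply: subringB (subring1 hA) _ => //; apply: subringM.
have powB n : exists2 c, A c & w ^+ n = 1 - x^-1 * c.
  elim: n => [|n [c Ac hc]]; first by exists 0; [exact: subring0|rewrite mulr0 subr0].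
  exists (c + w ^+ n * b).
    by apply: subringD => //; apply: subringM => //; apply: subringX.
  by rewrite exprSr {2}/w mulrBr mulr1 mulrCA {1}hc mulrDr opprD addrA.
have [c Ac hc] := powB (size p).
have : A (w ^+ size p * x).
  rewrite -hp horner_coef mulr_sumr; apply: subring_sum => // i _.
  rewrite mulrCA exprVn -expfB ?ltn_ord//.
  by apply: subringM => //; apply: subringX.
rewrite hc mulrBl mul1r -mulrA mulrCA mulVf// mulr1 => h.
by rewrite -(subrK c x); apply: subringD.
Qed.

(** Multiplied by a power of [z], the relation [x^-1 q(z^-1) = 1] expresses
    [z ^+ n.+1] through lower powers, since the coefficient [1 - x^-1 q_0] of
    its leading term is invertible in [A]. *)
Let descent z (p q : {poly E}) n m : z != 0 ->
  (forall i, A p`_i) -> (forall i, A q`_i) ->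
  (size p <= n.+2)%N -> (size q <= m.+2)%N -> (m <= n)%N ->
  p.[z] = x -> q.[z^-1] = x ->
  exists p' : {poly E}, [/\ forall i, A p'`_i, (size p' <= n.+1)%N & p'.[z] = x].
Proof.
move=> z0 Ap Aq sp sq mn pz qz.
have [w0 Aw] := unit_1B (Aq 0%N).
set w := 1 - _ in w0 Aw.
have zn : z ^+ n.+1 = \sum_(j < m.+1) x^-1 * (w^-1 * q`_j.+1) * z ^+ (n - j).
  have : w * z ^+ n.+1 = \sum_(j < m.+1) x^-1 * q`_j.+1 * z ^+ (n - j).
    rewrite /w mulrBl mul1r -[X in X - _]mul1r -(mulVf x0) -{2}qz.
    rewrite (horner_coef_wide _ sq) big_ord_recl /= expr0 mulr1.
    rewrite mulrDr mulrDl addrAC subrr add0r mulr_sumr mulr_suml.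
    apply: eq_bigr => j _; rewrite /bump /= add1n -!mulrA; congr (_ * (_ * _)).
    rewrite exprVn mulrC -[(n - j)%N]subSS exprB ?unitfE// ltnS.
    by apply: leq_trans mn; rewrite -ltnS.
  move/(congr1 (fun t => w^-1 * t)); rewrite mulKf// => ->.
  by rewrite mulr_sumr; apply: eq_bigr => j _; rewrite !mulrA [w^-1 * _]mulrC.
pose p' : {poly E} := \poly_(i < n.+1) p`_i +
   \sum_(j < m.+1) (p`_n.+1 * (x^-1 * (w^-1 * q`_j.+1))) *: 'X^(n - j).
exists p'; split.
- move=> i; rewrite /p' coefD coef_poly coef_sum; apply: subringD => //.
    by case: ifP => // _; exact: subring0.
  apply: subring_sum => // j _; rewrite coefZ coefXn.
  apply: subringM => //; last by case: (i == _); [exact: subring1|exact: subring0].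
  by apply: subringM => //; apply: subringM => //; apply: subringM.
- rewrite /p' (leq_trans (size_polyD _ _))// geq_max size_poly.
  apply: (leq_trans (size_sum _ _ _)); apply/bigmax_leqP => j _.
  by rewrite (leq_trans (size_scale_leq _ _))// size_polyXn ltnS leq_subr.
- rewrite /p' hornerD horner_poly horner_sum -[RHS]pz (horner_coef_wide _ sp).
  rewrite [RHS]big_ord_recr /= zn mulr_sumr; congr (_ + _).
  by apply: eq_bigr => j _; rewrite hornerZ hornerXn !mulrA.
Qed.

(** Chevalley's argument: if neither [z] nor [z^-1] were in [A], then [x] would
    be a polynomial over [A] in each of them, and the degrees of the two
    expressions could be lowered alternately without end. *)
Lemma maximal_subring_valuation z : A z \/ A z^-1.
Proof.
apply: contrapT => /not_orP[nz nzV].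
have z0 : z != 0 by apply/eqP => z0; apply: nz; rewrite z0; apply: subring0.
have [p Ap pz] := adjP nz; have [q Aq qz] := adjP nzV.
have : exists N n m (p q : {poly E}), [/\ (n + m <= N)%N,
    (size p <= n.+1)%N /\ (size q <= m.+1)%N,
    forall i, A p`_i, forall i, A q`_i & p.[z] = x /\ q.[z^-1] = x].
  by exists (size p + size q)%N, (size p), (size q), p, q; split => //; split.
move=> [N]; clear p q Ap Aq pz qz.
have const (r : {poly E}) t : (size r <= 1)%N -> (forall i, A r`_i) -> r.[t] = x -> False.
  move=> /size1_polyC -> Ar; rewrite hornerC => h.
  by apply: nAx; rewrite -h; have := Ar 0%N; rewrite coefC.
elim: N => [|N ih] [n [m [p [q [nm [sp sq] Ap Aq [pz qz]]]]]].
  move: nm; rewrite leqn0 addn_eq0 => /andP[/eqP n0 _]; rewrite n0 in sp.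
  exact: const sp Ap pz.
case: n m => [|n] [|m] in nm sp sq *; try by [exact: const sp Ap pz|exact: const sq Aq qz].
have [mn|/ltnW nm'] := leqP m n.
  have [p' [Ap' sp' pz']] := descent z0 Ap Aq sp sq mn pz qz.
  by apply: ih; exists n, m.+1, p', q; split.
have zV0 : z^-1 != 0 by rewrite invr_eq0.
have pz2 : p.[z^-1^-1] = x by rewrite invrK.
have [q' [Aq' sq' qz']] := descent zV0 Aq Ap sq sp nm' qz pz2.
by apply: ih; exists n.+1, m, p, q'; split => //; move: nm; rewrite addnS.
Qed.

End MaximalSubring.

Definition valuation_ring (E : fieldType) (V : set E) : Prop :=
  subring V /\ forall x, V x \/ V x^-1.

Definition integral_over_int (E : fieldType) (x : E) : Prop :=
  exists2 p : {poly int}, p \is monic & root (map_poly intr p) x.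

(** Clearing denominators in an expression of [x] as a polynomial in [x^-1]
    makes [x] integral, so [x] is not in [Z[x^-1]]. A subring which is maximal
    among those that contain [x^-1] and omit [x] is a valuation ring. *)
Lemma nonintegral_valuation_ring (E : fieldType) (x : E) :
  ~ integral_over_int x -> exists2 V, valuation_ring V & ~ V x.
Proof.
move=> nx.
have x0 : x != 0.
  apply/eqP => x0; apply: nx; exists 'X; first exact: monicX.
  by rewrite map_polyX x0 rootX.
pose Zy : set E := [set w | exists p : {poly int}, (map_poly intr p).[x^-1] = w].
have Zy_sub : subring Zy.
  split; first by exists 1; rewrite rmorph1 hornerC.
  - by move=> _ _ [p <-] [q <-]; exists (p - q); rewrite rmorphB /= !hornerE.
  - by move=> _ _ [p <-] [q <-]; exists (p * q); rewrite rmorphM /= !hornerE.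
have Zyx : ~ Zy x.
  move=> [p hp]; apply: nx.
  pose n := size p.
  exists ('X^(n.+1) - \sum_(i < n) p`_i *: 'X^(n - i)).
    apply/monicP; rewrite lead_coefDl ?lead_coefXn// size_polyN size_polyXn ltnS.
    apply: (leq_trans (size_sum _ _ _)); apply/bigmax_leqP => j _.
    by rewrite (leq_trans (size_scale_leq _ _))// size_polyXn ltnS leq_subr.
  apply/rootP; rewrite rmorphB /= map_polyXn raddf_sum /= !hornerE horner_sum.
  rewrite exprSr -[X in _ * X]hp (@horner_coef_wide _ n); last exact: size_poly.
  rewrite mulr_sumr; apply/eqP; rewrite subr_eq0; apply/eqP/eq_bigr => i _.
  rewrite coef_map /= map_polyZ /= map_polyXn hornerZ hornerXn.
  by rewrite mulrCA exprVn exprB ?unitfE// ltnW.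
(* Membership of 1 and of x^-1 is asked of nonempty sets only, so that the
   union of the empty chain is allowed. *)
pose P (X : set E) := [/\ X !=set0 -> X 1 /\ X x^-1,
   forall a b, X a -> X b -> X (a - b),
   forall a b, X a -> X b -> X (a * b) & ~ X x].
have [A [PA maxA]] : exists A, P A /\ forall B, A `<` B -> ~ P B.
  apply: Zorn_bigcup => F FP tot; split.
  - move=> [a [X FX Xa]]; have [] := FP _ FX => /(_ (ex_intro _ a Xa))[X1 Xy] _ _ _.
    by split; exists X.
  - move=> a b [X FX Xa] [Y FY Yb].
    have [XY|YX] := tot _ _ FX FY.
      by exists Y => //; have [_ + _ _] := FP _ FY; apply=> //; apply: XY.
    by exists X => //; have [_ + _ _] := FP _ FX; apply=> //; apply: YX.
  - move=> a b [X FX Xa] [Y FY Yb].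
    have [XY|YX] := tot _ _ FX FY.
      by exists Y => //; have [_ _ + _] := FP _ FY; apply=> //; apply: XY.
    by exists X => //; have [_ _ + _] := FP _ FX; apply=> //; apply: YX.
  - by move=> [X FX Xx]; have [_ _ _] := FP _ FX; apply.
have A0 : A !=set0.
  apply: contrapT => A0; apply: (maxA Zy).
    split; first by move=> a Aa; case: A0; exists a.
    by move=> ZA; apply: A0; exists 1; apply: ZA; case: Zy_sub.
  case: Zy_sub => Z1 ZB ZM; split => // _; split=> //.
  by exists 'X; rewrite map_polyX hornerX.
have [/(_ A0)[A1 Ay] AB AM Ax] := PA.
have hA : subring A by split.
exists A => //; split=> //.
apply: (maximal_subring_valuation hA Ay Ax) => B [B1 BB BM] AB' Bx b Bb.
apply: contrapT => Ab; apply: (maxA B); last by split => // _; split => //; apply: AB'.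
by split=> // /(_ b Bb).
Qed.

(** * Valuation rings and their nonunits *)

Section ValuationRingTheory.
Variables (E : fieldType) (V : set E).
Hypothesis hV : valuation_ring V.

Let sV : subring V. Proof. by case: hV. Qed.

Lemma valuation_inv x : ~ V x -> V x^-1.
Proof. by have [_ /(_ x)[]] := hV. Qed.

(** The maximal ideal of [W]. *)
Definition nonunit (W : set E) : set E := [set x | W x /\ (x = 0 \/ ~ W x^-1)].

Lemma nonunit_sub x : nonunit V x -> V x. Proof. by case. Qed.

Lemma nonunit0 : nonunit V 0.
Proof. by split; [exact: subring0|left]. Qed.

Lemma nonunit_inv x : ~ V x^-1 -> nonunit V x.
Proof. by move=> h; split; [rewrite -[x]invrK; apply: valuation_inv|right]. Qed.

Lemma unit_inv x : V x -> ~ nonunit V x -> x != 0 /\ V x^-1.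
Proof.
move=> Vx nx; split; last by apply: contrapT => h; apply/nx/nonunit_inv.
by apply/eqP => x0; apply: nx; rewrite x0; exact: nonunit0.
Qed.

Lemma nonunit1 : ~ nonunit V 1.
Proof. by move=> [V1 [/eqP|]]; rewrite ?oner_eq0 ?invr1. Qed.

Lemma nonunitMl x y : V x -> nonunit V y -> nonunit V (x * y).
Proof.
move=> Vx [Vy ny]; split; first exact: subringM.
have [->|x0] := eqVneq x 0; first by left; rewrite mul0r.
case: ny => [->|ny]; first by left; rewrite mulr0.
by right=> /(subringM sV Vx); rewrite invfM mulrA mulfV// mul1r.
Qed.

Lemma nonunitN x : nonunit V x -> nonunit V (- x).
Proof.
by rewrite -mulN1r; apply: nonunitMl; apply: subringN => //; apply: subring1.
Qed.

Lemma nonunitD x y : nonunit V x -> nonunit V y -> nonunit V (x + y).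
Proof.
have [->|x0] := eqVneq x 0; first by rewrite add0r.
have [->|y0] := eqVneq y 0; first by rewrite addr0.
wlog xy : x y x0 y0 / V (x / y) => [wl mx my|mx [Vy my]].
  have [] := hV.2 (x / y) => [h|]; first exact: wl.
  by rewrite invf_div addrC => h; apply: wl.
split; first by apply: subringD => //; apply: nonunit_sub mx.
have [|s0] := eqVneq (x + y) 0; [by left|right => Vs].
case: my => [/eqP|]; first by rewrite (negPf y0).
apply; rewrite (_ : y^-1 = (x / y + 1) * (x + y)^-1).
  by apply: subringM => //; apply: subringD => //; apply: subring1.
by rewrite -[X in _ / _ + X](mulfV y0) -mulrDl mulrAC mulfV// mul1r.
Qed.

Lemma nonunit_sum I (r : seq I) (P : pred I) (F : I -> E) :
  (forall i, P i -> nonunit V (F i)) -> nonunit V (\sum_(i <- r | P i) F i).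
Proof. by move=> h; apply: big_ind; [exact: nonunit0|exact: nonunitD|]. Qed.

Lemma unit_1B x : nonunit V x -> 1 - x != 0 /\ V (1 - x)^-1.
Proof.
move=> mx; apply: unit_inv => [|m1].
  by apply: subringB (subring1 sV) (nonunit_sub mx).
by apply: nonunit1; rewrite -(subrK x 1); apply: nonunitD.
Qed.

Lemma valuation_rootX x n : V (x ^+ n.+1) -> V x.
Proof.
move=> Vxn; apply: contrapT => nVx; have VxV := valuation_inv nVx.
have x0 : x != 0 by apply/eqP => x0; apply: nVx; rewrite x0; apply: subring0.
apply: nVx; rewrite (_ : x = x ^+ n.+1 * x^-1 ^+ n).
  by apply: subringM => //; apply: subringX.
by rewrite exprVn exprS mulfK// expf_neq0.
Qed.

(** If [x] is not in [V], then [x^-1] is, and dividing the equation of [x] by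
    the power of [x] one below its degree puts [x] in [V]. *)
Lemma valuation_integral (p : {poly E}) x :
  p \is monic -> (forall i, V p`_i) -> root p x -> V x.
Proof.
move=> mon_p Vp /rootP px; apply: contrapT => nVx; have VxV := valuation_inv nVx.
have x0 : x != 0 by apply/eqP => x0; apply: nVx; rewrite x0; apply: subring0.
have := px; rewrite horner_coef.
case sp : (size p) => [|n].
  by move/eqP: sp; rewrite size_poly_eq0 (negPf (monic_neq0 mon_p)).
rewrite big_ord_recr /=.
have -> : p`_n = 1 by rewrite -(monicP mon_p) /lead_coef sp.
rewrite mul1r => /eqP; rewrite addrC addr_eq0 => /eqP xn.
apply: nVx; case: n => [|n] in sp xn *.
  by move/eqP: xn; rewrite expr0 big_ord0 oppr0 oner_eq0.
rewrite (_ : x = - \sum_(i < n.+1) p`_i * x^-1 ^+ (n - i)).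
  apply: subringN => //; apply: subring_sum => // i _.
  by apply: subringM => //; apply: subringX.
have := congr1 (fun t => t / x ^+ n) xn; rewrite exprS mulfK ?expf_neq0// => {1}->.
rewrite mulNr mulr_suml; congr (- _); apply: eq_bigr => i _.
by rewrite -mulrA exprVn exprB ?unitfE// ?invf_div// -ltnS.
Qed.

Lemma most_divisible (s : seq E) :
  s != [::] -> all (predC1 0) s -> exists2 y, y \in s & forall z, z \in s -> V (z / y).
Proof.
elim: s => // a s ih _ /andP[/= a0 s0].
have aa : V (a / a) by rewrite mulfV//; apply: subring1.
have [->|s_nil] := eqVneq s [::].
  by exists a; rewrite ?mem_head// => z; rewrite inE => /eqP->.
have [y ys hy] := ih s_nil s0; have y0 : y != 0 by apply: (allP s0).
have [ay|] := hV.2 (a / y).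
  exists y; first by rewrite inE ys orbT.
  by move=> z; rewrite inE => /predU1P[->|/hy].
rewrite invf_div => ya; exists a; first exact: mem_head.
move=> z; rewrite inE => /predU1P[->//|/hy zy].
rewrite (_ : z / a = z / y * (y / a)); first exact: subringM.
by rewrite mulrA mulfVK.
Qed.

(** If a single term divided all the others strictly, dividing the sum by it
    would exhibit 1 as a sum of nonunits. *)
Lemma two_dominant_terms n (F : 'I_n -> E) (i0 : 'I_n) :
  \sum_i F i = 0 -> F i0 != 0 ->
  exists i j, [/\ i != j, F i != 0, F j != 0, V (F i / F j) & V (F j / F i)].
Proof.
move=> sumF Fi0.
have [] := @most_divisible [seq x <- codom F | x != 0].
- by rewrite -has_filter; apply/hasP; exists (F i0); rewrite ?codom_f.
- exact: filter_all.
move=> y; rewrite mem_filter => /andP[y0 /codomP[i yE]] hy.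
rewrite {}yE in y0 hy *.
have VF j : V (F j / F i).
  have [->|Fj] := eqVneq (F j) 0; first by rewrite mul0r; apply: subring0.
  by apply: hy; rewrite mem_filter Fj codom_f.
have [[j [ij nj]]|no] := pselect (exists j, j != i /\ ~ nonunit V (F j / F i)).
  have [] := unit_inv (VF j) nj; rewrite invf_div => Fji VFij.
  exists j, i; split => //; apply: contra_neq Fji => ->; by rewrite mul0r.
exfalso; apply: nonunit1.
have : \sum_j F j / F i = 0 by rewrite -mulr_suml sumF mul0r.
rewrite (bigD1 i)//= mulfV// => /eqP; rewrite addr_eq0 => /eqP ->.
apply: nonunitN; apply: nonunit_sum => j ji; apply: contrapT => nj.
by apply: no; exists j.
Qed.

End ValuationRingTheory.

Section NumberFieldValuation.
Variable K : fieldExtType rat.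

Lemma rat_int_scale (I : finType) (k : I -> rat) :
  exists D : int, D != 0 /\ exists b : I -> int, forall i, (b i)%:~R = k i * D%:~R.
Proof.
exists (\prod_i denq (k i)); split; first by apply/prodf_neq0 => i _; apply: denq_neq0.
exists (fun i => numq (k i) * \prod_(j | j != i) denq (k j)) => i.
rewrite [X in _ * X%:~R](bigD1 i)//= !intrM mulrA; congr (_ * _).
by rewrite -[X in X * _]divq_num_den mulfVK// intr_eq0 denq_neq0.
Qed.

Lemma number_field_int_eq0 (k : int) : (k%:~R == 0 :> K) = (k == 0).
Proof. by rewrite -(rmorph_int (in_alg K)) fmorph_eq0 intr_eq0. Qed.

(** A family longer than the degree satisfies a rational, hence an integral,
    linear relation; dividing it by the common powers of [p] leaves a
    coefficient prime to [p]. *)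
Lemma primitive_relation (p r : nat) (x : 'I_r -> K) :
  prime p -> (\dim {:K} < r)%N ->
  exists a : 'I_r -> int,
    \sum_i (a i)%:~R * x i = 0 /\ exists i, ~~ (p %| a i)%Z.
Proof.
move=> pr_p dr.
have nfree : ~~ free [tuple x i | i < r].
  apply/negP => /eqP h; have := dimvS (subvf <<[tuple x i | i < r]>>).
  by rewrite h size_tuple leqNgt dr.
have [k [ksum [i0 ki0]]] : exists k : 'I_r -> rat,
    \sum_i k i *: x i = 0 /\ exists i, k i != 0.
  apply: contrapT => no; move/negP: nfree; apply; apply/freeP => k ksum i.
  apply: contrapT => /eqP ki; apply: no; exists k; split; last by exists i.
  rewrite -[RHS]ksum; apply: eq_bigr => j _.
  by rewrite (nth_map j) ?nth_ord_enum ?size_enum_ord.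
have [D [D0 [b bE]]] := rat_int_scale k.
have : exists N : nat, exists b : 'I_r -> int,
    [/\ (`|b i0| <= N)%N, b i0 != 0 & \sum_i (b i)%:~R * x i = 0].
  exists `|b i0|%N, b; split => //.
    by rewrite -(intr_eq0 rat) bE mulf_neq0 ?intr_eq0.
  transitivity (D%:~R * \sum_i k i *: x i); last by rewrite ksum mulr0.
  rewrite mulr_sumr; apply: eq_bigr => i _.
  have -> : (b i)%:~R = D%:~R * (k i)%:A :> K.
    by rewrite -!(rmorph_int (in_alg K)) bE rmorphM mulrC.
  by rewrite -mulrA mulr_algl.
move=> [N]; elim: N => [|N ih] [c [cN c0 csum]].
  by move: cN; rewrite leqn0 absz_eq0 (negPf c0).
have [alld|] := pselect (forall i, (p %| c i)%Z); last first.
  by move=> /existsNP[i /negP hi]; exists c; split => //; exists i.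
pose c' i := (c i %/ p%:Z)%Z.
have cE i : c i = c' i * p%:Z by rewrite /c' divzK.
apply: ih; exists c'; split.
- have c'0 : c' i0 != 0 by apply: contra_neq c0 => h; rewrite cE h mul0r.
  rewrite -ltnS (leq_trans _ cN)// cE abszM absz_nat ltn_Pmulr ?prime_gt1//.
  by rewrite absz_gt0.
- by apply: contra_neq c0 => h; rewrite cE h mul0r.
apply: (mulfI (_ : (p%:Z)%:~R != 0)).
  by rewrite number_field_int_eq0; case: p pr_p {alld c' cE}.
rewrite mulr0 -[RHS]csum mulr_sumr; apply: eq_bigr => i _.
by rewrite cE intrM mulrA [_ * (p%:Z)%:~R]mulrC.
Qed.

End NumberFieldValuation.

Section DiscreteValuation.
Variables (K : fieldExtType rat) (V : set K) (p : nat).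
Hypotheses (hV : valuation_ring V) (pr_p : prime p) (pV : ~ V p%:R^-1).

Let sV : subring V. Proof. by case: hV. Qed.

Let p0 : p%:R != 0 :> K.
Proof. by apply/eqP => p0; apply: pV; rewrite p0 invr0; apply: subring0. Qed.

Let mp : nonunit V p%:R. Proof. exact: nonunit_inv. Qed.

Lemma bezout_prime (a : int) : ~~ (p %| a)%Z -> exists u w : int, u * a + w * p%:Z = 1.
Proof.
move=> pa; have : coprimez a p by rewrite coprimezE coprime_sym prime_coprime.
by move=> /coprimezP[[u w] /= h]; exists u, w.
Qed.

Lemma prime_to_unit (a : int) : ~~ (p %| a)%Z -> V a%:~R^-1.
Proof.
move=> /bezout_prime[u [w h]]; apply: contrapT => nVa.
apply: (@nonunit1 K V); rewrite -[1](rmorph1 (@intmul K 1)) -h !rmorphD /= !rmorphM /=.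
apply: nonunitD => //; apply: nonunitMl => //; try exact: subring_int.
exact: nonunit_inv.
Qed.

(** Linear independence, over the prime field, of classes modulo [pV]. *)
Let indep r (x : 'I_r -> K) := (forall i, V (x i)) /\
  forall a : 'I_r -> int, V ((\sum_i (a i)%:~R * x i) / p%:R) -> forall i, (p %| a i)%Z.

Let indep_le r (x : 'I_r -> K) : indep x -> (r <= \dim {:K})%N.
Proof.
move=> [_ hx]; rewrite leqNgt; apply/negP.
move=> /(primitive_relation x pr_p)[a [asum [i /negP]]]; apply; apply: hx.
by rewrite asum mul0r; apply: subring0.
Qed.

(** Lifts of elements independent over the prime field are independent over the
    rationals, so [V / pV] has dimension at most the degree of [K]. The list
    [s] consists of the combinations, with coefficients below [p], of a family
    that is independent and longest possible. *)
Lemma finite_mod_prime :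
  exists s : seq K, forall x, V x -> exists2 y, y \in s & V ((x - y) / p%:R).
Proof.
have [r [x [hx maxr]]] : exists r (x : 'I_r -> K), indep x /\
    forall y : 'I_r.+1 -> K, ~ indep y.
  apply: contrapT => no.
  have all_r r : exists x : 'I_r -> K, indep x.
    elim: r => [|r [x hx]]; first by exists (fun=> 0); split => [[]|? _ []].
    apply: contrapT => no'; apply: no; exists r, x; split=> // y hy.
    by apply: no'; exists y.
  by have [x /indep_le] := all_r (\dim {:K}).+1; rewrite ltnn.
exists [seq \sum_j (val (f j))%:R * x j | f : {ffun 'I_r -> 'I_p}] => z Vz.
pose y (i : 'I_r.+1) := if unlift ord0 i is Some j then x j else z.
have y_0 : y ord0 = z by rewrite /y unlift_none.
have y_S j : y (lift ord0 j) = x j by rewrite /y liftK.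
have Vx : forall i, V (x i) by case: hx.
have Vy i : V (y i) by rewrite /y; case: unlift.
have [a [aV [i0 ai0]]] : exists a : 'I_r.+1 -> int,
    V ((\sum_i (a i)%:~R * y i) / p%:R) /\ exists i, ~~ (p %| a i)%Z.
  apply: contrapT => no; apply: (maxr y); split => // a aV i.
  by apply: contrapT => /negP pa; apply: no; exists a; split => //; exists i.
rewrite big_ord_recl y_0 in aV.
rewrite (eq_bigr (fun j => (a (lift ord0 j))%:~R * x j)) in aV; last first.
  by move=> j _; rewrite y_S.
pose b j := a (lift ord0 j).
have pa0 : ~~ (p %| a ord0)%Z.
  apply/negP => /dvdzP[a' a'E].
  have Sb : V ((\sum_j (b j)%:~R * x j) / p%:R).
    rewrite (_ : _ / _ = ((a ord0)%:~R * z + \sum_j (b j)%:~R * x j) / p%:R - a'%:~R * z).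
      by apply: subringB => //; apply: subringM => //; apply: subring_int.
    by rewrite a'E intrM -pmulrn; field.
  move: ai0; apply/negP/negPn.
  case: (unliftP ord0 i0) => [j|] ->; last by rewrite a'E dvdz_mull.
  by have [_ /(_ b Sb j)] := hx.
have [u [w uw]] := bezout_prime pa0.
pose c j := ((- (u * b j)) %% p)%Z.
have p_neq0 : p%:Z != 0 by case: p pr_p.
have c_ge0 j : 0 <= c j by apply: modz_ge0.
have c_lt j : (`|c j| < p)%N.
  by rewrite -ltz_nat gez0_abs//; apply: ltz_pmod; case: p pr_p.
exists (\sum_j (c j)%:~R * x j).
  apply/mapP; exists [ffun j => Ordinal (c_lt j)]; first exact: mem_enum.
  apply: eq_bigr => j _; rewrite ffunE /= -[X in X%:~R](gez0_abs (c_ge0 j)).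
  by rewrite pmulrn.
pose d j := ((- (u * b j)) %/ p)%Z.
have dE j : (c j)%:~R = - (u%:~R * (b j)%:~R) - (d j)%:~R * p%:R :> K.
  have := congr1 (fun t => t%:~R : K) (divz_eq (- (u * b j)) p).
  by rewrite mulrNz intrM intrD intrM -pmulrn -/(c j) -/(d j) => ->; ring.
rewrite (_ : _ / _ = u%:~R * (((a ord0)%:~R * z + \sum_j (b j)%:~R * x j) / p%:R)
   + w%:~R * z + \sum_j (d j)%:~R * x j).
  do 2?[apply: subringD => //]; rewrite ?subring_int//.
  - by apply: subringM => //; apply: subring_int.
  - by apply: subringM => //; apply: subring_int.
  - by apply: subring_sum => // j _; apply: subringM => //; apply: subring_int.
have -> : \sum_j (c j)%:~R * x j = - (u%:~R * \sum_j (b j)%:~R * x j) -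
    (\sum_j (d j)%:~R * x j) * p%:R.
  rewrite mulr_sumr mulr_suml -sumrN -sumrB; apply: eq_bigr => j _.
  by rewrite dE; ring.
have : (u * a ord0 + w * p%:Z)%:~R = 1 :> K by rewrite uw.
rewrite intrD !intrM -pmulrn => h.
have {1}-> : z = (u%:~R * (a ord0)%:~R + w%:~R * p%:R) * z by rewrite h mul1r.
by field.
Qed.

End DiscreteValuation.

(** * Uniformizers of valuation rings of number fields *)

Section Uniformizer.
Variables (K : fieldExtType rat) (V : set K) (p : nat).
Hypotheses (hV : valuation_ring V) (pr_p : prime p) (pV : ~ V p%:R^-1).

Let sV : subring V. Proof. by case: hV. Qed.

Let p0 : p%:R != 0 :> K.
Proof. by apply/eqP => p0; apply: pV; rewrite p0 invr0; apply: subring0. Qed.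

Let mp : nonunit V p%:R. Proof. exact: nonunit_inv. Qed.

Let Vp : V p%:R. Proof. exact: nonunit_sub mp. Qed.

Lemma nonunit_mod_prime x y : V ((x - y) / p%:R) -> nonunit V (x - y).
Proof. by move=> h; rewrite -(mulfVK p0 (x - y)); apply: nonunitMl. Qed.

(** The quotient [y / x] differs from 1 by a multiple of [p / x], which is a
    nonunit because [x] is outside [pV]. *)
Lemma associated_mod_prime x y : V x -> ~ V (x / p%:R) -> V ((x - y) / p%:R) ->
  [/\ y != 0, V (x / y) & V (y / x)].
Proof.
move=> Vx nxp hxy.
have x0 : x != 0 by apply/eqP => x0; apply: nxp; rewrite x0 mul0r; apply: subring0.
have mpx : nonunit V (p%:R / x) by apply: nonunit_inv => //; rewrite invf_div.
have : nonunit V (p%:R / x * ((x - y) / p%:R)) by rewrite mulrC; apply: nonunitMl.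
have -> : p%:R / x * ((x - y) / p%:R) = 1 - y / x.
  by field; rewrite x0 p0.
move=> /(unit_1B hV)[]; rewrite opprB addrCA subrr addr0 => yx Vyx.
have y0 : y != 0 by apply: contra_neq yx => ->; rewrite mul0r.
split=> //; first by rewrite -invf_div.
rewrite (_ : y / x = 1 - (1 - y / x)); last by rewrite opprB addrCA subrr addr0.
apply: subringB => //; first exact: subring1.
rewrite (_ : 1 - y / x = (x - y) / p%:R * (p%:R / x)); last by field; rewrite x0 p0.
by apply: subringM => //; case: mpx.
Qed.

(** Every element outside [pV] is associated to one of finitely many
    representatives of [V / pV], so among the nonunits there is one that
    divides all the others. *)
Lemma uniformizer_exists :
  exists pi, [/\ pi != 0, nonunit V pi & forall x, nonunit V x -> V (x / pi)].
Proof.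
have [s hs] := finite_mod_prime hV pr_p pV.
pose s' := p%:R :: [seq y <- s | `[< nonunit V y >] && (y != 0)].
have [||pi pis hpi] := @most_divisible _ _ hV s' => //.
  by rewrite /= p0 /=; apply/allP => y; rewrite mem_filter => /andP[/andP[]].
have pi_p : V (p%:R / pi) by apply: hpi; exact: mem_head.
have [mpi pi0] : nonunit V pi /\ pi != 0.
  move: pis; rewrite inE => /predU1P[->//|].
  by rewrite mem_filter => /andP[/andP[/asboolP]].
exists pi; split=> // x mx; have Vx := nonunit_sub mx.
have [Vxp|nxp] := pselect (V (x / p%:R)).
  rewrite (_ : x / pi = x / p%:R * (p%:R / pi)); first exact: subringM.
  by rewrite mulrA mulfVK.
have [y ys hxy] := hs x Vx; have [y0 Vxy Vyx] := associated_mod_prime Vx nxp hxy.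
rewrite (_ : x / pi = x / y * (y / pi)); last by rewrite mulrA mulfVK.
apply: subringM => //; apply: hpi; rewrite inE mem_filter ys y0 !andbT.
apply/orP; right; apply/asboolP.
have x0 : x != 0 by apply/eqP => x0; apply: nxp; rewrite x0 mul0r; apply: subring0.
by rewrite -(mulfVK x0 y); apply: nonunitMl.
Qed.

Section WithUniformizer.
Variable pi : K.
Hypotheses (pi0 : pi != 0) (mpi : nonunit V pi)
           (hpi : forall x, nonunit V x -> V (x / pi)).

Let npiV : ~ V pi^-1.
Proof. by case: mpi => _ [/eqP|//]; rewrite (negPf pi0). Qed.

Let Vpi : V pi. Proof. exact: nonunit_sub mpi. Qed.

Lemma uniformizer_expN n : V (pi ^- n.+1) -> False.
Proof.
move=> h; apply: npiV; rewrite (_ : pi^-1 = pi ^+ n * pi ^- n.+1).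
  by apply: subringM => //; apply: subringX.
by rewrite exprSr invfM mulrA mulfV ?mul1r// expf_neq0.
Qed.

Lemma uniformizer_expz (k : int) : V (pi ^ k) <-> 0 <= k.
Proof.
split; last by case: k => // n _; apply: subringX.
by case: k => // n /uniformizer_expN.
Qed.

(** If all powers of [pi] divided [p], they would lie outside [pV], and two of
    them would be congruent modulo [pV], hence associated. *)
Let prime_bounded : exists N, ~ V (p%:R / pi ^+ N).
Proof.
apply: contrapT => /forallNP no; have {}no N : V (p%:R / pi ^+ N).
  by apply: contrapT; apply: no.
have [s hs] := finite_mod_prime hV pr_p pV.
have nVk k : ~ V (pi ^+ k / p%:R).
  move=> h; apply: npiV; rewrite (_ : pi^-1 = pi ^+ k / p%:R * (p%:R / pi ^+ k.+1)).
    exact: subringM.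
  by rewrite mulrA mulfVK// exprSr invfM mulrA mulfV ?mul1r// expf_neq0.
have /choice[y hy] : forall k, exists y, y \in s /\ V ((pi ^+ k - y) / p%:R).
  by move=> k; have [|y ys hy] := hs (pi ^+ k); [exact: subringX|exists y].
have [i [j [ij yij]]] := values_collide (fun k => (hy k).1).
have [yi0 Vi _] := associated_mod_prime (subringX sV i Vpi) (nVk i) (hy i).2.
have [_ _ Vj] := associated_mod_prime (subringX sV j Vpi) (nVk j) (hy j).2.
apply: (@uniformizer_expN (j - i).-1); rewrite prednK ?subn_gt0//.
rewrite (_ : pi ^- (j - i) = pi ^+ i / y i * (y j / pi ^+ j)); first exact: subringM.
by rewrite -yij mulrA mulfVK// exprB ?unitfE// ?invf_div// ltnW.
Qed.

(** If the quotient of [x] by the largest power of [pi] dividing it were not a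
    unit, it could be divided by [pi] once more. *)
Let bounded_associated x N : V x -> x != 0 -> ~ V (x / pi ^+ N) ->
  exists k, V (x / pi ^+ k) /\ V (pi ^+ k / x).
Proof.
move=> Vx x0 hN.
have exN : exists n, `[< ~ V (x / pi ^+ n) >] by exists N; apply/asboolP.
case: (ex_minnP exN) => -[|n] /asboolP nVn minn.
  by case: nVn; rewrite expr0 divr1.
have Vn : V (x / pi ^+ n).
  by apply: contrapT => h; have /asboolP/minn := h; rewrite ltnn.
exists n; split=> //; rewrite -invf_div; apply: contrapT => nV.
apply: nVn; rewrite exprSr invfM mulrA.
by apply: hpi; apply: nonunit_inv.
Qed.

(** In an integral relation for [x], the lowest nonzero coefficient is a multiple
    of [x]; up to a unit, this coefficient is a power of [p]. *)
Let divides_prime_power x : V x -> x != 0 -> exists M, V (p%:R ^+ M / x).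
Proof.
move=> Vx x0.
have [a [asum [i1 ai1]]] :=
  @primitive_relation K p (\dim {:K}).+1 (fun i => x ^+ i) pr_p (ltnSn _).
have exi : exists i : nat, [exists j : 'I_(\dim {:K}).+1, (val j == i) && (a j != 0)].
  exists (val i1); apply/existsP; exists i1; rewrite eqxx/=.
  by apply: contraNneq ai1 => ->; rewrite dvdz0.
case: (ex_minnP exi) => _ /existsP[i /andP[/eqP <- ai]] mini.
have Vax : V ((a i)%:~R / x).
  have lt0 (j : 'I_(\dim {:K}).+1) : (j < i)%N -> a j = 0.
    move=> ji; apply/eqP; apply: contraTT ji => aj; rewrite -leqNgt; apply: mini.
    by apply/existsP; exists j; rewrite eqxx.
  rewrite (_ : _ / _ = - \sum_(j | j != i) (a j)%:~R * (x ^+ j / x ^+ i.+1)).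
    apply: subringN => //; apply: subring_sum => // j ji.
    have [lt_ji|lt_ij|/val_inj/eqP] := ltngtP j i; last by rewrite (negPf ji).
      by rewrite lt0// mul0r; apply: subring0.
    apply: subringM => //; first exact: subring_int.
    by rewrite -exprB ?unitfE//; apply: subringX.
  have : (\sum_j (a j)%:~R * x ^+ j) / x ^+ i.+1 = 0 by rewrite asum mul0r.
  rewrite (bigD1 i)//= mulrDl => /eqP; rewrite addr_eq0 => /eqP h.
  rewrite (_ : _ / x = (a i)%:~R * x ^+ i / x ^+ i.+1).
    by rewrite h mulr_suml; congr (- _); apply: eq_bigr => j _; rewrite mulrA.
  by rewrite exprS -mulrA invfM [x ^+ _ * _]mulrCA mulfV ?mulr1// expf_neq0.
have ai_gt0 : (0 < `|a i|)%N by rewrite absz_gt0.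
have [c pc aE] := pfactor_coprime pr_p ai_gt0.
move: (logn p _) aE => m aE; exists m.
have nVc : V c%:R^-1.
  rewrite pmulrn; apply: (prime_to_unit hV pr_p pV).
  by rewrite prime_coprime in pc.
rewrite (_ : _ / x = c%:R^-1 * ((-1) ^+ (a i < 0)%R * ((a i)%:~R / x))).
  apply: subringM => //; apply: subringM => //; apply: subringX => //.
  by apply: subringN => //; exact: subring1.
have c0 : c%:R != 0 :> K.
  rewrite pmulrn number_field_int_eq0; case: c pc {nVc} aE => // _.
  by rewrite mul0n => aE; rewrite aE in ai_gt0.
rewrite [X in X%:~R]intEsign intrM rmorph_sign aE PoszM intrM -!pmulrn natrX.
set e := (-1) ^+ _; have e2 : e * e = 1 by rewrite -expr2 sqrr_sign.
rewrite [RHS](_ : _ = e * e * (c%:R^-1 * c%:R) * (p%:R ^+ m / x)); last by ring.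
by rewrite e2 mulVf// !mul1r.
Qed.

(** The powers of [pi] that divide [x] are bounded: [x] divides a power of [p],
    and [p] is itself associated to a power of [pi]. *)
Lemma uniformizer_associated x : x != 0 ->
  exists k : int, V (x / pi ^ k) /\ V (pi ^ k / x).
Proof.
wlog Vx : x / V x => [wl x0|x0].
  have [/wl|nVx] := pselect (V x); first exact.
  have [|k [h1 h2]] := wl _ (valuation_inv hV nVx); first by rewrite invr_eq0.
  rewrite invrK in h2; exists (- k); rewrite -invr_expz invrK.
  by split; rewrite mulrC.
have [N hN] := prime_bounded.
have [e [_ Ve]] := bounded_associated Vp p0 hN.
have [M hM] := divides_prime_power Vx x0.
have [|k [h1 h2]] := @bounded_associated x (e * M).+1 Vx x0.
  move=> h; apply: (@uniformizer_expN 0); rewrite expr1.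
  rewrite (_ : pi^-1 = (pi ^+ e / p%:R) ^+ M * (p%:R ^+ M / x) * (x / pi ^+ (e * M).+1)).
    by apply: subringM => //; apply: subringM => //; apply: subringX.
  rewrite exprSr exprM expr_div_n; set A := (pi ^+ e) ^+ M.
  have A0 : A != 0 by rewrite !expf_neq0.
  have B0 : p%:R ^+ M != 0 :> K by rewrite expf_neq0.
  by field; rewrite A0 B0 x0 pi0.
by exists k%:Z.
Qed.

End WithUniformizer.
End Uniformizer.

(** * The finite place attached to a valuation ring *)

Section ResidueCharacteristic.
Variables (K : fieldExtType rat) (V : set K).
Hypothesis hV : valuation_ring V.

Let sV : subring V. Proof. by case: hV. Qed.

(** Otherwise [V] contains the rationals, over which all of [K] is integral. *)
Lemma residue_char : (exists x, ~ V x) -> exists2 p, prime p & ~ V p%:R^-1.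
Proof.
move=> [x nVx]; apply: contrapT => no.
have Vp p : prime p -> V p%:R^-1.
  by move=> pr_p; apply: contrapT => h; apply: no; exists p.
have Vn n : (0 < n)%N -> V n%:R^-1.
  elim/ltn_ind: n => n ih n0; have [n1|n1] := leqP n 1.
    have -> : n = 1%N by apply/eqP; rewrite eqn_leq n1.
    by rewrite invr1; exact: subring1.
  rewrite -(divnK (pdiv_dvd n)) natrM invfM; apply: subringM => //.
    apply: ih; last by rewrite divn_gt0 ?pdiv_gt0// pdiv_leq.
    by rewrite ltn_Pdiv// prime_gt1// pdiv_prime.
  by apply/Vp/pdiv_prime.
have Vq (q : rat) : V q%:A.
  rewrite -(divq_num_den q) -in_algE fmorph_div !rmorph_int.
  apply: subringM => //; first exact: subring_int.
  by rewrite -[denq q]gez0_abs ?denq_ge0// -pmulrn; apply: Vn; rewrite absz_gt0 denq_neq0.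
apply: nVx; apply: (@valuation_integral K V hV (minPoly 1%AS x)).
- exact: monic_minPoly.
- move=> i; have /polyOverP/(_ i)/vlineP[q ->] := minPolyOver 1%AS x.
  exact: Vq.
- exact: root_minPoly.
Qed.

End ResidueCharacteristic.

Section PlaceOfValuationRing.
Variables (R : realType) (K : fieldExtType rat) (V : set K).
Hypotheses (hV : valuation_ring V) (V_proper : exists x, ~ V x).

Let sV : subring V. Proof. by case: hV. Qed.

(** The base [q] of the absolute value has to be the cardinality of the residue
    field, which the definition of a place reads off from the absolute value;
    hence [q] is first computed from [V] alone. *)
Lemma place_of_valuation_ring :
  exists2 v : K -> R, finite_places v & forall x, v x <= 1 <-> V x.
Proof.
have [p pr_p pV] := residue_char hV V_proper.
have [pi [pi0 mpi hpi]] := uniformizer_exists hV pr_p pV.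
have npiV : ~ V pi^-1 by case: mpi => _ [/eqP|//]; rewrite (negPf pi0).
have Vpik := uniformizer_expz hV pi0 mpi.
have /choice[ord hord] : forall x, exists k : int, x != 0 ->
    V (x / pi ^ k) /\ V (pi ^ k / x).
  move=> x; have [->|x0] := eqVneq x 0; first by exists 0.
  by have [k hk] := uniformizer_associated hV pr_p pV pi0 mpi hpi x0; exists k.
have Vord x : x != 0 -> V x <-> 0 <= ord x.
  move=> x0; have [h1 h2] := hord x x0; split => [Vx|k0].
    by apply/Vpik; rewrite -(mulfVK x0 (pi ^ _)); apply: subringM.
  rewrite -(mulfVK (expfz_neq0 (ord x) pi0) x); apply: subringM => //.
  by apply/Vpik.
have ord_uniq x k : x != 0 -> V (x / pi ^ k) -> V (pi ^ k / x) -> ord x = k.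
  move=> x0 h1 h2; have [h3 h4] := hord x x0; have pik := expfz_neq0 k pi0.
  have pio := expfz_neq0 (ord x) pi0.
  apply/eqP; rewrite eq_le; apply/andP; split.
    rewrite -subr_ge0; apply/Vpik; rewrite expfzDr// -invr_expz.
    rewrite (_ : _ / _ = pi ^ k / x * (x / pi ^ ord x)); first exact: subringM.
    by rewrite mulrA mulfVK.
  rewrite -subr_ge0; apply/Vpik; rewrite expfzDr// -invr_expz.
  rewrite (_ : _ / _ = pi ^ ord x / x * (x / pi ^ k)); first exact: subringM.
  by rewrite mulrA mulfVK.
have ordM x y : x != 0 -> y != 0 -> ord (x * y) = ord x + ord y.
  move=> x0 y0; have [h1 h2] := hord x x0; have [h3 h4] := hord y y0.
  have pix := expfz_neq0 (ord x) pi0; have piy := expfz_neq0 (ord y) pi0.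
  apply: ord_uniq; rewrite ?mulf_neq0// expfzDr//.
    rewrite (_ : _ / _ = x / pi ^ ord x * (y / pi ^ ord y)); first exact: subringM.
    by field; rewrite pix piy.
  rewrite (_ : _ / _ = pi ^ ord x / x * (pi ^ ord y / y)); first exact: subringM.
  by field; rewrite x0 y0.
have ord_pi k : ord (pi ^ k) = k.
  by apply: ord_uniq; rewrite ?expfz_neq0// mulfV ?expfz_neq0//; exact: subring1.
have nonunitP x : nonunit V x <-> x = 0 \/ 0 < ord x.
  have [->|x0] := eqVneq x 0.
    by split; [left|move=> _; exact: nonunit0].
  have oV : ord x^-1 = - ord x.
    apply/eqP; rewrite -addr_eq0 -ordM ?invr_eq0// mulVf//.
    by rewrite -(ord_pi 0).
  have xV0 : x^-1 != 0 by rewrite invr_eq0.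
  split=> [[Vx [/eqP|nVx]]|[/eqP|ox]]; rewrite ?(negPf x0)//.
    by right; rewrite ltNge -oppr_ge0 -oV; apply/negP => /(Vord _ xV0).
  by apply: nonunit_inv => // /(Vord _ xV0); rewrite oV oppr_ge0 leNgt ox.
pose residues : set (set K) := [set [set y | nonunit V (y - x)] | x in V].
have fin_res : finite_set residues.
  have [s hs] := finite_mod_prime hV pr_p pV.
  apply: (@sub_finite_set _ _ [set [set y | nonunit V (y - x)] | x in [set` s]]);
    last by apply: finite_image; exact: finite_seq.
  move=> _ [x Vx <-]; have [y ys hxy] := hs x Vx; exists y => //.
  have mxy := nonunit_mod_prime hV pV hxy.
  apply/seteqP; split=> z /= hz.
    by rewrite (_ : z - x = (z - y) - (x - y)); [apply: nonunitD => //; apply: nonunitN|ring].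
  by rewrite (_ : z - y = (z - x) + (x - y)); [apply: nonunitD|ring].
pose q := #|` fset_set residues|.
have q_gt1 : (1 < q)%N.
  pose c x : set K := [set y | nonunit V (y - x)].
  have c01 : c 0 != c 1.
    apply/eqP => c01; have : c 1 0 by rewrite -c01 /c /= subr0; exact: nonunit0.
    rewrite /c /= sub0r => /(nonunitN hV); rewrite opprK; exact: nonunit1.
  have <- : #|` [fset c 0; c 1]%fset| = 2%N by rewrite cardfs2 c01.
  apply: fsubset_leq_card; apply/fsubsetP => w; rewrite !inE in_fset_set// => h.
  apply/mem_set; case/orP: h => /eqP ->.
    by exists 0 => //; exact: subring0.
  by exists 1 => //; exact: subring1.
have q0 : 0 < q%:R :> R by rewrite ltr0n ltnW.
have q1 : 1 < q%:R :> R by rewrite ltr1n.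
pose v x : R := if x == 0 then 0 else q%:R ^ (- ord x).
have v_le1 x : v x <= 1 <-> V x.
  rewrite /v; have [->|x0] := eqVneq x 0.
    by rewrite ler01; split => // _; exact: subring0.
  rewrite -[X in _ <= X](expr0z q%:R) ler_eXz2l// oppr_le0.
  by split=> /(Vord _ x0).
have v_lt1 x : v x < 1 <-> nonunit V x.
  rewrite nonunitP /v; have [->|x0] := eqVneq x 0.
    by rewrite ltr01; split => // _; left.
  rewrite -[X in _ < X](expr0z q%:R) ltr_eXz2l// oppr_lt0.
  by split=> [|[/eqP|//]]; [right|rewrite (negPf x0)].
have vM x y : v (x * y) = v x * v y.
  rewrite /v mulf_eq0; have [->|x0] := eqVneq x 0; first by rewrite /= mul0r.
  have [->|y0] := eqVneq y 0; first by rewrite /= mulr0.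
  by rewrite /= ordM// opprD expfzDr// gt_eqF.
have v_ge0 x : 0 <= v x by rewrite /v; case: ifP => // _; rewrite exprz_ge0// ltW.
have res_v : residue_field v = residues.
  rewrite /residue_field /residues.
  have -> : [set x | v x <= 1] = V by apply/seteqP; split=> x /v_le1.
  apply: eq_imagel => x _; apply/seteqP.
  by split=> y /=; exact: (v_lt1 _).1 || exact: (v_lt1 _).2.
exists v => //; split.
- move=> x; rewrite /v; have [->|x0] := eqVneq x 0; first by [].
  split=> [/eqP|/eqP]; last by rewrite (negPf x0).
  by rewrite gt_eqF// exprz_gt0.
- exact: vM.
- move=> x y.
  wlog xy : x y / v x <= v y => [wl|].
    by have /orP[/wl//|/wl] := le_total (v x) (v y); rewrite addrC maxC.
  rewrite max_r//; have [y0|y0] := eqVneq y 0.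
    have : v x = 0 by apply/eqP; rewrite eq_le v_ge0 andbT (le_trans xy)// /v y0 eqxx.
    rewrite y0 addr0 => ->; exact: v_ge0.
  rewrite -(mulfVK y0 (x + y)) vM ler_piMl//; apply/v_le1.
  rewrite mulrDl mulfV//; apply: subringD => //; last exact: subring1.
  have vy : 0 < v y by rewrite /v (negPf y0) exprz_gt0.
  apply/v_le1; rewrite -(ler_pM2r vy) -vM mulfVK// mul1r.
  exact: xy.
- by rewrite res_v.
- rewrite /residue_card res_v -/q; apply/seteqP; split => [_ [x /= x0 <-]|_ [k _ <-]].
    by exists (- ord x) => //; rewrite /v (negPf x0).
  exists (pi ^ (- k)); first exact: expfz_neq0.
  by rewrite /v (negPf (expfz_neq0 _ pi0)) ord_pi opprK.
Qed.

End PlaceOfValuationRing.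

(** * Finite places: weak approximation and finiteness of poles *)

Section PlaceTheory.
Variables (R : realType) (K : fieldExtType rat).

Section OnePlace.
Variable v : K -> R.
Hypothesis hv : finite_places v.

Lemma place_eq0 x : v x = 0 <-> x = 0. Proof. by case: hv => + _ _ _ _; apply. Qed.
Lemma placeM x y : v (x * y) = v x * v y. Proof. by case: hv => _ + _ _ _; apply. Qed.
Lemma placeD_le x y : v (x + y) <= Num.max (v x) (v y).
Proof. by case: hv => _ _ + _ _; apply. Qed.

Lemma place1 : v 1 = 1.
Proof.
have v1 : v 1 != 0 by apply/eqP => /place_eq0/eqP; rewrite oner_eq0.
by apply: (mulfI v1); rewrite -placeM !mulr1.
Qed.

Lemma place_val x : x != 0 -> exists k : int, v x = (residue_card v)%:R ^ k.
Proof.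
move=> x0; have [_ _ _ _ vals] := hv.
have : range (fun k : int => (residue_card v)%:R ^ k : R) (v x).
  by rewrite -vals; exists x.
by move=> [k _ <-]; exists k.
Qed.

Lemma place_ge0 x : 0 <= v x.
Proof.
have [->|/place_val[k ->]] := eqVneq x 0; last by rewrite exprz_ge0 ?ler0n.
by rewrite (_ : v 0 = 0)//; apply/place_eq0.
Qed.

Lemma place_gt0 x : x != 0 -> 0 < v x.
Proof.
move=> x0; rewrite lt_neqAle place_ge0 andbT eq_sym.
by apply/eqP => /place_eq0/eqP; rewrite (negPf x0).
Qed.

Lemma place0 : v 0 = 0. Proof. exact/place_eq0. Qed.

Lemma placeV x : v x^-1 = (v x)^-1.
Proof.
have [->|x0] := eqVneq x 0; first by rewrite invr0 place0 invr0.
apply: (mulfI (lt0r_neq0 (place_gt0 x0))).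
by rewrite -placeM !mulfV ?place1 ?lt0r_neq0 ?place_gt0.
Qed.

Lemma placeX x n : v (x ^+ n) = v x ^+ n.
Proof. by elim: n => [|n ih]; rewrite ?place1// !exprS placeM ih. Qed.

Lemma placeXz x (k : int) : v (x ^ k) = v x ^ k.
Proof. by case: k => n; [exact: placeX|rewrite NegzE -!invr_expz placeV placeX]. Qed.

Lemma placeN x : v (- x) = v x.
Proof.
have vN1 : v (-1) = 1.
  have : v (-1) ^+ 2 = 1 by rewrite -placeX sqrrN expr1n place1.
  by move/eqP; rewrite sqrp_eq1 ?place_ge0// => /eqP.
by rewrite -mulN1r placeM vN1 mul1r.
Qed.

Lemma place_sum_lt I (r : seq I) (P : pred I) (F : I -> K) (t : R) :
  0 < t -> (forall i, P i -> v (F i) < t) -> v (\sum_(i <- r | P i) F i) < t.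
Proof.
move=> t0 h; apply: (big_ind (fun x => v x < t)) => [|x y vx vy|]; first by rewrite place0.
  by rewrite (le_lt_trans (placeD_le _ _))// gt_max vx.
exact: h.
Qed.

Lemma place_valuation_ring : valuation_ring [set x | v x <= 1].
Proof.
split; last first.
  move=> x /=; have [->|x0] := eqVneq x 0; first by left; rewrite place0.
  have [h|/ltW h] := lerP (v x) 1; [by left|right].
  by rewrite placeV invf_le1// place_gt0.
split=> [|x y vx vy|x y vx vy] /=; first by rewrite place1.
  by rewrite (le_trans (placeD_le _ _))// placeN ge_max vx.
by rewrite placeM mulr_ile1 ?place_ge0.
Qed.

Lemma residue_card_gt1 : (1 < residue_card v)%N.
Proof.
have [_ _ _ fin _] := hv.
pose c x : set K := [set y | v (y - x) < 1].
have c01 : c 0 != c 1.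
  apply/eqP => c01; have : c 1 0 by rewrite -c01 /c /= subr0 place0.
  by rewrite /c /= sub0r placeN place1 ltxx.
have <- : #|` [fset c 0; c 1]%fset| = 2%N by rewrite cardfs2 c01.
apply: fsubset_leq_card; apply/fsubsetP => w; rewrite !inE in_fset_set// => h.
apply/mem_set; case/orP: h => /eqP ->.
  by exists 0; rewrite //= place0.
by exists 1; rewrite //= place1.
Qed.

Let q1 : 1 < (residue_card v)%:R :> R.
Proof. by rewrite ltr1n residue_card_gt1. Qed.

Lemma place_ge2 x : 1 < v x -> 2 <= v x.
Proof.
have [->|/place_val[k ->]] := eqVneq x 0; first by rewrite place0 ltr10.
rewrite -[X in X < _](expr0z (residue_card v)%:R) ltr_eXz2l// => k0.
apply: (@le_trans _ _ ((residue_card v)%:R ^ 1)); last by rewrite ler_eXz2l.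
by rewrite expr1z ler_nat residue_card_gt1.
Qed.

Lemma place_le_half x : v x < 1 -> v x <= 2^-1.
Proof.
have [->|x0 vx] := eqVneq x 0; first by rewrite place0 invr_ge0 ler0n.
have := @place_ge2 x^-1; rewrite placeV invf_gt1 ?place_gt0// => /(_ vx).
by move=> h; rewrite -[v x]invrK lef_pV2 ?posrE ?invr_gt0 ?place_gt0.
Qed.

Lemma place_proper : exists x, 1 < v x.
Proof.
have [_ _ _ _ vals] := hv.
have : [set v x | x in [set x | x != 0]] ((residue_card v)%:R ^ 1).
  by rewrite vals; exists 1.
by move=> [x _ h]; exists x; rewrite h expr1z.
Qed.

Lemma place_uniformizer : exists2 x, x != 0 & v x = (residue_card v)%:R ^ (-1).
Proof.
have [_ _ _ _ vals] := hv.
have : [set v x | x in [set x | x != 0]] ((residue_card v)%:R ^ (-1)).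
  by rewrite vals; exists (-1).
by move=> [x x0 h]; exists x.
Qed.

Lemma place_int (k : int) : v k%:~R <= 1.
Proof. exact: (subring_int (proj1 place_valuation_ring) k). Qed.

Lemma place_prime_to (p : nat) (a : int) :
  prime p -> v p%:R < 1 -> ~~ (p %| a)%Z -> v a%:~R = 1.
Proof.
move=> pr_p vp pa; apply/eqP; rewrite eq_le place_int /=.
have p0 : p%:R != 0 :> K by rewrite pmulrn number_field_int_eq0; case: p pr_p {vp pa}.
have nVp : ~ [set x | v x <= 1] p%:R^-1.
  by rewrite /= placeV; apply/negP; rewrite -ltNge invf_gt1 ?place_gt0.
have /= := prime_to_unit place_valuation_ring pr_p nVp pa.
rewrite placeV invf_le1// place_gt0// number_field_int_eq0.
by apply: contraNneq pa => ->; rewrite dvdz0.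
Qed.

(** The values are powers of an integer greater than 1, so a value below 1 is at
    most 1/2. *)
Lemma place_exp_small x (c : R) : v x < 1 -> 0 <= c ->
  exists N, forall n, (N <= n)%N -> v x ^+ n * c < 1.
Proof.
move=> /place_le_half vx c0; exists (Num.bound c) => n hn.
have : v x ^+ n * c <= 2^-1 ^+ n * c.
  by rewrite ler_wpM2r// lerXn2r ?nnegrE ?place_ge0 ?invr_ge0.
move=> /le_lt_trans; apply; rewrite exprVn mulrC ltr_pdivrMr ?exprn_gt0// mul1r.
apply: (lt_le_trans (archi_boundP c0)); rewrite -natrX ler_nat.
by apply: leq_trans hn _; apply/ltnW/ltn_expl.
Qed.

Lemma place_1D_gt t : 1 < v t -> v (t / (1 + t)) = 1.
Proof.
move=> vt; have t0 : t != 0 by apply: contraTneq vt => ->; rewrite place0 ltr10.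
rewrite placeM placeV; suff -> : v (1 + t) = v t by rewrite mulfV// gt_eqF ?place_gt0.
apply/eqP; rewrite eq_le; apply/andP; split.
  by rewrite (le_trans (placeD_le _ _))// place1 max_r// ltW.
have := placeD_le (1 + t) (-1); rewrite addrAC subrr add0r placeN place1.
by rewrite le_max => /orP[//|/le_lt_trans/(_ vt)]; rewrite ltxx.
Qed.

Lemma place_1D_lt t : v t < 1 -> v (t / (1 + t)) = v t.
Proof.
move=> vt; rewrite placeM placeV; suff -> : v (1 + t) = 1 by rewrite invr1 mulr1.
apply/eqP; rewrite eq_le; apply/andP; split.
  by rewrite (le_trans (placeD_le _ _))// place1 max_l// ltW.
have := placeD_le (1 + t) (- t); rewrite addrK placeN place1.
by rewrite le_max => /orP[//|/le_lt_trans/(_ vt)]; rewrite ltxx.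
Qed.

End OnePlace.

(** A discrete valuation ring is a maximal proper subring, so an inclusion
    between rings of integers is an equality. The residue cardinalities then
    agree, and so do the values at a uniformizer. *)
Lemma place_le1_eq (v w : K -> R) : finite_places v -> finite_places w ->
  (forall c, v c <= 1 -> w c <= 1) -> v = w.
Proof.
move=> hv hw vw.
have lt1 c : v c < 1 -> w c < 1.
  move=> vc; rewrite lt_neqAle vw ?ltW// andbT; apply/eqP => wc.
  have [z wz] := place_proper hw.
  have [N /(_ N (leqnn N)) hN] := place_exp_small hv vc (place_ge0 hv z).
  have : w (c ^+ N * z) <= 1 by apply: vw; rewrite placeM// placeX// ltW.
  by rewrite placeM// placeX// wc expr1n mul1r leNgt wz.
have inv_lt (u : K -> R) (hu : finite_places u) c : (u c^-1 < 1) = (c == 0) || (1 < u c).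
  have [->|c0] := eqVneq c 0; first by rewrite invr0 place0 ?ltr01.
  by rewrite placeV// invf_lt1 ?place_gt0.
have le1 c : (v c <= 1) = (w c <= 1).
  apply/idP/idP => [/vw//|wc]; rewrite leNgt; apply/negP => vc.
  have := lt1 c^-1; rewrite !inv_lt// vc orbT => /(_ isT) /orP[/eqP c0|].
    by move: vc; rewrite c0 place0 ?ltr10.
  by rewrite ltNge wc.
have lt1E c : (v c < 1) = (w c < 1).
  have [->|c0] := eqVneq c 0; first by rewrite !place0.
  by rewrite -[c]invrK !inv_lt// !invr_eq0 (negPf c0) !ltNge le1.
have eq1 c : v c = 1 -> w c = 1.
  move=> vc; apply/eqP; rewrite eq_le -le1 vc lexx /= leNgt -lt1E vc.
  by rewrite ltxx.
have eq_res : residue_field v = residue_field w.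
  rewrite /residue_field; have -> : [set x | v x <= 1] = [set x | w x <= 1].
    by apply/seteqP; split=> x /=; rewrite le1.
  by apply: eq_imagel => x _; apply/seteqP; split=> y /=; rewrite lt1E.
have eq_q : residue_card v = residue_card w by rewrite /residue_card eq_res.
have q1 : 1 < (residue_card v)%:R :> R by rewrite ltr1n residue_card_gt1.
have q0 := lt_trans ltr01 q1.
have expI : injective (exprz ((residue_card v)%:R : R)) by apply: ieexprIz; rewrite ?gt_eqF.
have [x x0 wx] := place_uniformizer hw; have [p p0 vp] := place_uniformizer hv.
rewrite -eq_q in wx.
have key y j : y != 0 -> v y = (residue_card v)%:R ^ j -> w y = w p ^ (- j).
  move=> y0 vy; have wpj : w p ^ j != 0 by rewrite expfz_neq0// gt_eqF// place_gt0.
  apply: (mulIf wpj); rewrite -[in RHS]invr_expz mulVf// -placeXz// -placeM//.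
  apply: eq1; rewrite placeM// placeXz// vy vp exprz_exp mulN1r -invr_expz mulfV//.
  by rewrite expfz_neq0// gt_eqF.
have [m] := place_val hw p0; rewrite -eq_q => wp.
have [j vx] := place_val hv x0.
have mj : m * j = 1.
  have := key _ _ x0 vx; rewrite wx wp exprz_exp => /expI.
  by rewrite mulrN => /oppr_inj.
have m_lt0 : m < 0.
  have : w p < 1.
    by rewrite -lt1E vp -[X in _ < X](expr0z (residue_card v)%:R) ltr_eXz2l.
  by rewrite wp -[X in _ < X](expr0z (residue_card v)%:R) ltr_eXz2l.
have m1 : m = -1.
  have /eqP : (`|m| * `|j| = 1)%N by rewrite -abszM mj.
  rewrite muln_eq1 => /andP[/eqP m1 _].
  by rewrite -[LHS]opprK -[- m]gez0_abs ?oppr_ge0 ?ltW// abszN m1.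
apply/funext => y; have [->|y0] := eqVneq y 0; first by rewrite !place0.
have [k vy] := place_val hv y0.
by rewrite (key _ _ y0 vy) wp m1 exprz_exp mulN1r opprK.
Qed.

Lemma separate_two_places (v w : K -> R) : finite_places v -> finite_places w ->
  v != w -> exists c, 1 < v c /\ w c < 1.
Proof.
move=> hv hw vw.
have sep (u u' : K -> R) (hu : finite_places u) (hu' : finite_places u') :
    u != u' -> exists a : K, u a <= 1 /\ 1 < u' a.
  move=> uu'; apply: contrapT => no; move/eqP: uu'.
    apply; apply: (place_le1_eq hu hu') => c uc.
  by rewrite leNgt; apply/negP => u'c; apply: no; exists c.
have [a [va wa]] := sep v w hv hw vw.
have [b [wb vb]] := sep w v hw hv (contra_neq (@esym _ _ _) vw).
exists (b / a); rewrite !placeM// !placeV//.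
have va0 : 0 < v a.
  by apply: place_gt0 => //; apply: contraTneq wa => ->; rewrite place0 ?ltr10.
split; first by rewrite ltr_pdivlMr// mul1r (le_lt_trans va).
by rewrite ltr_pdivrMr ?mul1r ?(le_lt_trans wb)// (lt_trans ltr01).
Qed.

(** Weak approximation, by induction on the list. Let [z] work for the tail, and
    let [c] separate [v] from the new place [w0]. A high power of [z], or of
    [z / (1 + z)] in case [z] is large at [w0], dominates [c] at the places of
    the tail without spoiling it at [v] and [w0]. *)
Lemma separate_places (v : K -> R) (ws : seq (K -> R)) : finite_places v ->
  (forall w, w \in ws -> finite_places w /\ v != w) ->
  exists z, 1 < v z /\ forall w, w \in ws -> w z < 1.
Proof.
move=> hv; elim: ws => [|w0 ws ih] hws.
  by have [z vz] := place_proper hv; exists z.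
have [z [vz wz]] : exists z, 1 < v z /\ forall w, w \in ws -> w z < 1.
  by apply: ih => w ww; apply: hws; rewrite inE ww orbT.
have [hw0 vw0] := hws w0 (mem_head _ _).
have [c [vc wc]] := separate_two_places hv hw0 vw0.
have hw w : w \in ws -> finite_places w.
  by move=> ww; have [] := hws w; rewrite ?inE ?ww ?orbT.
have [N hN] : exists N, forall n, (N <= n)%N -> forall w, w \in ws -> w z ^+ n * w c < 1.
  elim: ws {ih hws} wz hw => [|w ws ih] wz hw; first by exists 0%N.
  have [||N hN] := ih; [by move=> u uw; apply: wz; rewrite inE uw orbT
                       |by move=> u uw; apply: hw; rewrite inE uw orbT|].
  have hw' := hw w (mem_head _ _).
  have [M hM] := place_exp_small hw' (wz w (mem_head _ _)) (place_ge0 hw' c).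
  exists (maxn N M) => n; rewrite geq_max => /andP[Nn Mn] u.
  by rewrite inE => /predU1P[->|uw]; [exact: hM|exact: hN].
pose n := N.+1.
have vzn : 1 < v (z ^+ n) by rewrite placeX// exprn_egt1.
have [w0z|w0z] := leP (w0 z) 1.
  exists (z ^+ n * c); split=> [|w].
    by rewrite placeM// (lt_trans vzn)// ltr_pMr// (lt_trans ltr01).
  rewrite inE => /predU1P[->|ww].
    rewrite placeM// placeX// (le_lt_trans _ wc)// ler_piMl ?place_ge0//.
    by rewrite exprn_ile1// place_ge0.
  by rewrite placeM ?placeX ?hN//; exact: hw.
exists (z ^+ n / (1 + z ^+ n) * c); split=> [|w].
  by rewrite placeM// place_1D_gt// mul1r.
rewrite inE => /predU1P[->|ww].
  have w0zn : 1 < w0 (z ^+ n) by rewrite placeX// exprn_egt1.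
  by rewrite placeM// place_1D_gt// mul1r.
have hww := hw w ww.
have wzn : w (z ^+ n) < 1 by rewrite placeX// exprn_ilt1 ?place_ge0 ?wz.
by rewrite placeM// place_1D_lt// placeX// hN.
Qed.

(** Elements given by weak approximation, one per place above [p], are linearly
    independent over the rationals: in a relation with a coefficient prime to
    [p], the term of this coefficient is the only large one at its place. *)
Lemma card_places_above (p : nat) (vs : seq (K -> R)) : prime p -> uniq vs ->
  (forall v, v \in vs -> finite_places v /\ v p%:R < 1) -> (size vs <= \dim {:K})%N.
Proof.
move=> pr_p uvs hvs; rewrite leqNgt; apply/negP => lt_d.
pose v (i : 'I_(size vs)) := nth (fun=> 0) vs i.
have vin i : v i \in vs by apply: mem_nth.
have vE i j : (v i == v j) = (i == j) by rewrite nth_uniq.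
have hv i : finite_places (v i) by have [] := hvs _ (vin i).
have vp i : v i p%:R < 1 by have [] := hvs _ (vin i).
have /choice[z hz] : forall i, exists z, 1 < v i z /\ forall j, j != i -> v j z < 1.
  move=> i; have [|z [h1 h2]] := @separate_places (v i) (rem (v i) vs) (hv i).
    move=> w; rewrite mem_rem_uniq// !inE => /andP[wv ww].
    by have [] := hvs _ ww; rewrite eq_sym.
  exists z; split=> // j ji; apply: h2.
  by rewrite mem_rem_uniq// !inE vin vE ji.
have [a [asum [i pai]]] := primitive_relation z pr_p lt_d.
have : 1 < v i ((a i)%:~R * z i).
  by rewrite placeM// (place_prime_to _ pr_p)// mul1r; case: (hz i).
move: asum; rewrite (bigD1 i)//= => /eqP; rewrite addr_eq0 => /eqP ->.
apply/negP; rewrite -leNgt placeN// ltW//; apply: place_sum_lt => // j ji.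
rewrite placeM// (le_lt_trans (ler_piMl _ (place_int _ _)))// ?place_ge0//.
by have [_] := hz j; apply; rewrite eq_sym.
Qed.

Lemma finite_places_above (p : nat) : prime p ->
  finite_set [set v : K -> R | finite_places v /\ v p%:R < 1].
Proof.
move=> pr_p; apply: contrapT => /(infinite_set_fset (\dim {:K}).+1)[B BA].
rewrite leqNgt ltnS => /negP; apply.
by apply: card_places_above pr_p (fset_uniq _) _ => v /BA.
Qed.

(** Take for [D], up to sign, the leading coefficient of an integral relation for
    [x]. Where [x] has a pole, the leading term would exceed all the others if
    [D] had value 1. *)
Lemma denominator_exists (x : K) : exists2 D : nat, (0 < D)%N &
  forall v : K -> R, finite_places v -> 1 < v x -> v D%:R < 1.
Proof.
have [a [asum [i1 ai1]]] :=
  @primitive_relation K 2 (\dim {:K}).+1 (fun i => x ^+ i) isT (ltnSn _).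
have ai1' : a i1 != 0 by apply: contraNneq ai1 => ->; rewrite dvdz0.
have [i ai maxi] := @arg_maxnP _ i1 (fun i => a i != 0) val ai1'.
exists `|a i|%N; first by rewrite absz_gt0.
move=> v hv vx; have -> : v `|a i|%:R = v (a i)%:~R.
  rewrite [in RHS](intEsign (a i)) intrM rmorph_sign pmulrn mulr_sign.
  by case: ifP; rewrite ?placeN.
rewrite lt_neqAle place_int// andbT; apply/eqP => vai.
have vx0 : 0 < v x by rewrite (lt_trans ltr01).
move: asum; rewrite (bigD1 i)//= => /eqP; rewrite addr_eq0 => /eqP h.
have := congr1 v h; rewrite placeN// placeM// vai mul1r placeX// => vE.
have : v (\sum_(j | j != i) (a j)%:~R * x ^+ j) < v x ^+ i.
  apply: place_sum_lt => //; first exact: exprn_gt0.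
  move=> j ji; have [->|aj] := eqVneq (a j) 0.
    by rewrite mul0r place0// exprn_gt0.
  rewrite placeM// placeX// (le_lt_trans (ler_piMl _ (place_int _ _)))//.
    by rewrite exprn_ge0// ltW.
  rewrite ltr_eXn2l// ltn_neqAle (maxi _ aj : (j <= i)%N) andbT.
  by apply: contra_neq ji => /val_inj.
by rewrite vE ltxx.
Qed.

(** The poles of [x] lie above the primes dividing a denominator of [x], with
    finitely many places above each. This makes the product over the finite
    places in the height a genuine product. *)
Lemma finite_poles (x : K) : finite_set [set v : K -> R | finite_places v /\ 1 < v x].
Proof.
have [D D0 hD] := denominator_exists x.
apply: (@sub_finite_set _ _ (\bigcup_(p in [set` primes D])
    [set v : K -> R | finite_places v /\ v p%:R < 1])); last first.
  apply: bigcup_finite; first exact: finite_seq.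
  by move=> p /=; rewrite mem_primes => /andP[/finite_places_above].
move=> v [hv vx]; have := hD v hv vx.
apply: contraPP => no; apply/negP; rewrite -leNgt.
have nop p : prime p -> (p %| D)%N -> 1 <= v p%:R.
  move=> pr_p pD; rewrite leNgt; apply/negP => vp; apply: no.
  by exists p => //=; rewrite mem_primes pr_p D0.
elim/ltn_ind: D D0 nop {hD no} => D ih D0 nop.
have [D1|D1] := leqP D 1.
  have -> : D = 1%N by apply/eqP; rewrite eqn_leq D1.
  by rewrite place1.
rewrite -(divnK (pdiv_dvd D)) natrM placeM// mulr_ege1//.
  apply: ih; rewrite ?divn_gt0 ?pdiv_gt0 ?pdiv_leq//.
    by rewrite ltn_Pdiv// prime_gt1// pdiv_prime.
  by move=> p pr_p pD; apply: nop => //; rewrite (dvdn_trans pD)// dvdn_div// pdiv_dvd.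
by apply: nop; rewrite ?pdiv_prime ?pdiv_dvd.
Qed.

End PlaceTheory.

(** * The height bounds the absolute values of the entries *)

Section NumberFieldGenerator.
Variable L : fieldExtType rat.

Lemma separable_rat (E F : {subfield L}) : separable E F.
Proof.
apply/separableP => x _; apply: pcharf0_separable.
exact: ftrans (pchar_lalg L) (pchar_num rat).
Qed.

Lemma number_field_generator :
  exists theta : L, forall x, exists q : {poly rat}, x = (map_poly (in_alg L) q).[theta].
Proof.
have h := eq_adjoin_separable_generator (separable_rat 1 {:L}) (subvf _).
exists (separable_generator 1 {:L}) => x.
have /Fadjoin1_polyP[q ->] : x \in <<1; separable_generator 1 {:L}>>%VS by rewrite -h memvf.
by exists q.
Qed.

Lemma rational_minPoly (x : L) : exists f : {poly rat},
  [/\ f \is monic, (size f <= (\dim {:L}).+1)%N, root (map_poly (in_alg L) f) x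
    & forall q : {poly rat}, root (map_poly (in_alg L) q) x -> f %| q].
Proof.
have /polyOver1P[f fE] := minPolyOver 1%AS x.
exists f; split.
- by rewrite -(map_monic (in_alg L)) -fE monic_minPoly.
- rewrite -(size_map_poly (in_alg L)) -fE size_minPoly ltnS.
  have := dim_Fadjoin 1 x; rewrite dimv1 muln1 => <-.
  exact/dimvS/subvf.
- by rewrite -fE root_minPoly.
- move=> q qx; rewrite -(dvdp_map (in_alg L)) -fE; apply: minPoly_dvdp => //.
  by apply/polyOver1P; exists q.
Qed.

Lemma rmorph_horner_rat (F : fieldType) (s : {rmorphism L -> F}) (q : {poly rat}) x :
  s (map_poly (in_alg L) q).[x] = (map_poly ratr q).[s x].
Proof.
rewrite -horner_map -map_poly_comp; congr _.[_]; apply: eq_map_poly => a /=.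
by rewrite rmorphZ_num rmorph1 mulr1.
Qed.

Lemma finite_embeddings (R : realType) : finite_set (@complex_embeddings R L).
Proof.
have [theta gen] := number_field_generator.
have [f [mon_f _ froot _]] := rational_minPoly theta.
have /choice[q qE] := gen.
have [r rE] := closed_field_poly_normal (map_poly ratr f : {poly R[i]}).
apply: (@sub_finite_set _ _ [set fun x => (map_poly ratr (q x)).[z] | z in [set` r]]);
  last by apply: finite_image; exact: finite_seq.
move=> _ [s _ <-]; exists (s theta).
  have f0 : map_poly ratr f != 0 :> {poly R[i]} by rewrite map_poly_eq0 monic_neq0.
  rewrite /= -(root_prod_XsubC r).
  rewrite -(rootZ _ _ (_ : lead_coef (map_poly ratr f) != 0)) ?lead_coef_eq0//.
  by rewrite -rE /root -rmorph_horner_rat (rootP froot) rmorph0.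
by apply/funext => x; rewrite -rmorph_horner_rat -qE.
Qed.

End NumberFieldGenerator.

Section FiniteProducts.
Variables (R : realType) (T : choiceType) (A : set T) (F : T -> R).
Hypotheses (F1 : forall t, A t -> 1 <= F t) (finF : finite_set [set t | A t /\ F t != 1]).

Let prodE : \big[*%R/1]_(t \in A) F t =
  \big[*%R/1]_(t <- fset_set [set t | A t /\ F t != 1]) F t.
Proof.
rewrite (fsbigE (fset_set [set t | A t /\ F t != 1])) ?fset_uniq//.
- rewrite big_seq_cond [RHS]big_seq; apply: eq_bigl => t.
  by rewrite in_fset_set//; apply: andb_idr => /set_mem[At _]; apply/mem_set.
- by move=> t /=; rewrite in_fset_set// => /set_mem[].
- move=> t At; rewrite in_fset_set// => tn; apply/eqP; apply: contraNT tn => Ft.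
  exact/mem_set.
Qed.

(** Finiteness of the support matters: otherwise the product is 1 by
    convention, and would bound none of its factors. *)
Lemma fsprod_ge1 : 1 <= \big[*%R/1]_(t \in A) F t.
Proof.
rewrite prodE big_seq; apply: (big_ind (fun x => 1 <= x)) => //.
  by move=> x y; exact: mulr_ege1.
by move=> t; rewrite in_fset_set// => /set_mem[/F1].
Qed.

Lemma fsprod_ge t : A t -> F t <= \big[*%R/1]_(t \in A) F t.
Proof.
move=> At; have [Ft|Ft] := eqVneq (F t) 1; first by rewrite Ft; exact: fsprod_ge1.
rewrite prodE (big_fsetD1 t)/=; last by rewrite in_fset_set//; apply/mem_set.
rewrite ler_peMr//; first by rewrite (le_trans ler01)// F1.
rewrite big_seq; apply: (big_ind (fun x => 1 <= x)) => //.
  by move=> x y; exact: mulr_ege1.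
by move=> u; rewrite in_fsetD1 in_fset_set// => /andP[_ /set_mem[/F1]].
Qed.

End FiniteProducts.

Section HeightBound.
Variables (R : realType) (K : fieldExtType rat) (n : nat) (A : 'M[K]_n).

Let x : 'rV[K]_(1 + n * n) := row_mx (1%:M : 'rV_1) (mxvec A).

Let le_coord (v : K -> R) j : v (x 0 j) <= coord_max x v.
Proof. by rewrite /coord_max; apply: (le_bigmax_cond _ (fun j => v (x 0 j))). Qed.

Let x0 : x 0 (lshift _ 0) = 1. Proof. by rewrite row_mxEl mxE. Qed.

Let xA i j : x 0 (rshift _ (mxvec_index i j)) = A i j.
Proof. by rewrite row_mxEr mxvecE. Qed.

Let coord_ge1 (v : K -> R) : v 1 = 1 -> 1 <= coord_max x v.
Proof. by move=> v1; rewrite -v1 -[X in v X]x0; exact: le_coord. Qed.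

Let normc_embedding (s : {rmorphism K -> R[i]}) :
  (@ComplexField.Normc.normc R \o s) 1 = 1.
Proof. by rewrite /= rmorph1 ComplexField.Normc.normc1. Qed.

Let inf_ge1 s : complex_embeddings s ->
  1 <= coord_max x (@ComplexField.Normc.normc R \o s).
Proof. by move=> [s' _ <-]; apply: coord_ge1; exact: normc_embedding. Qed.

Let inf_fin : finite_set [set s | @complex_embeddings R K s /\
  coord_max x (@ComplexField.Normc.normc R \o s) != 1].
Proof. by apply: sub_finite_set (@finite_embeddings K R) => s []. Qed.

Let fin_ge1 (v : K -> R) : finite_places v -> 1 <= coord_max x v.
Proof. by move=> hv; apply: coord_ge1; exact: place1. Qed.

Let fin_fin : finite_set [set v : K -> R | finite_places v /\ coord_max x v != 1].
Proof.
apply: (@sub_finite_set _ _ (\bigcup_(j in [set: 'I_(1 + n * n)])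
    [set v : K -> R | finite_places v /\ 1 < v (x 0 j)])); last first.
  by apply: bigcup_finite => // j _; exact: finite_poles.
move=> v [hv vx]; apply: contrapT => no; move/eqP: vx; apply.
apply/eqP; rewrite eq_le fin_ge1// andbT; apply: bigmax_le => // j _.
by rewrite leNgt; apply/negP => vj; apply: no; exists j.
Qed.

Let heightE : mx_height R A ^+ \dim {:K} =
   (\big[*%R/1]_(s \in @complex_embeddings R K)
      coord_max x (@ComplexField.Normc.normc R \o s)) *
   (\big[*%R/1]_(v \in @finite_places R K) coord_max x v).
Proof.
rewrite /mx_height /weil_height -/x -powR_mulrn ?powR_ge0// -powRrM mulVf.
  rewrite powRr1// mulr_ge0// (le_trans ler01)//.
    exact: fsprod_ge1 inf_ge1 inf_fin.
  exact: fsprod_ge1 fin_ge1 fin_fin.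
by rewrite pnatr_eq0 -lt0n adim_gt0.
Qed.

Lemma mx_height_ge1 : 1 <= mx_height R A ^+ \dim {:K}.
Proof.
rewrite heightE mulr_ege1//.
  exact: fsprod_ge1 inf_ge1 inf_fin.
exact: fsprod_ge1 fin_ge1 fin_fin.
Qed.

(** As 1 is one of the coordinates, every factor in the height is at least 1, so
    that the height dominates each of its factors. *)
Lemma mx_height_embedding (s : {rmorphism K -> R[i]}) i j :
  ComplexField.Normc.normc (s (A i j)) <= mx_height R A ^+ \dim {:K}.
Proof.
have hs : @complex_embeddings R K s by exists s.
rewrite heightE -(xA i j) (le_trans (le_coord (@ComplexField.Normc.normc R \o s) _))//.
rewrite (le_trans (fsprod_ge inf_ge1 inf_fin hs))// ler_peMr//.
  by rewrite (le_trans ler01)//; exact: fsprod_ge1 inf_ge1 inf_fin.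
exact: fsprod_ge1 fin_ge1 fin_fin.
Qed.

Lemma mx_height_place (v : K -> R) i j : finite_places v ->
  v (A i j) <= mx_height R A ^+ \dim {:K}.
Proof.
move=> hv; rewrite heightE -(xA i j) (le_trans (le_coord _ _))//.
rewrite (le_trans (fsprod_ge fin_ge1 fin_fin hv))// ler_peMl//.
  by rewrite (le_trans ler01)//; exact: fsprod_ge1 fin_ge1 fin_fin.
exact: fsprod_ge1 inf_ge1 inf_fin.
Qed.

End HeightBound.

(** * Eigenvalues of polynomials in a matrix; the complex absolute value *)

Section SpectralMapping.

Lemma rmorphism_exists (L F : pzRingType) (s : L -> F) :
  zmod_morphism s -> monoid_morphism s -> exists s' : {rmorphism L -> F}, s' =1 s.
Proof.
move=> sB sM.
pose s' : {rmorphism L -> F} := HB.pack s (GRing.isZmodMorphism.Build L F s sB)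
  (GRing.isMonoidMorphism.Build L F s sM).
by exists s'.
Qed.

(** A companion matrix, of a size that is visibly a successor, so that square
    matrices of this size form a ring. *)
Lemma char_poly_exists (S : comNzRingType) (p : {poly S}) :
  p \is monic -> (1 < size p)%N -> exists n (A : 'M[S]_n.+1), char_poly A = p.
Proof.
move=> mon_p sp; move: (companionmx p) (companionmxK mon_p).
rewrite -(subnKC sp) /= => A <-; by exists (size p - 2)%N, A.
Qed.

Lemma root_char_poly_horner (F : fieldType) n (A : 'M[F]_n.+1) p r :
  root (char_poly A) r -> root (char_poly (horner_mx A p)) p.[r].
Proof.
rewrite -!eigenvalue_root_char => /eigenvalueP[v vA v0]; apply/eigenvalueP; exists v => //.
elim/poly_ind: p => [|p c ih]; first by rewrite rmorph0 mulmx0 horner0 scale0r.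
rewrite rmorphD rmorphM /= horner_mx_X horner_mx_C mulmxDr hornerMXaddC.
rewrite mulmxA ih -scalemxAl vA scalerA scalerDl; congr (_ + _).
by rewrite mul_mx_scalar.
Qed.

(** Spectral mapping: [p - z] splits into linear factors, the determinant of its
    value at [A] vanishes, hence so does that of one of the factors. *)
Lemma char_poly_horner_root (F : closedFieldType) n (A : 'M[F]_n.+1) p z :
  root (char_poly (horner_mx A p)) z -> exists2 r, root (char_poly A) r & p.[r] = z.
Proof.
have [pz|pz] := eqVneq (p - z%:P) 0.
  move=> _; have [r rA] : exists r, root (char_poly A) r.
    by apply/closed_rootP; rewrite size_char_poly.
  by exists r => //; move/eqP: pz; rewrite subr_eq0 => /eqP ->; rewrite hornerC.
have [r rE] := closed_field_poly_normal (p - z%:P).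
rewrite -eigenvalue_root_char => /eigenvalueP[v vA v0].
have : ~~ (horner_mx A (p - z%:P) \in unitmx).
  apply/negP => u; move/eqP: v0; apply.
  have : v *m horner_mx A (p - z%:P) = 0.
    by rewrite rmorphB /= horner_mx_C mulmxBr vA mul_mx_scalar subrr.
  by move/(congr1 (mulmx^~ (invmx (horner_mx A (p - z%:P))))); rewrite mulmxK// mul0mx.
rewrite rE linearZ rmorph_prod /= unitmxE detZ.
rewrite (big_morph determinant (@det_mulmx _ _) (@det1 _ _)).
rewrite unitfE mulf_eq0 expf_eq0 lead_coef_eq0 (negPf pz) andbF /= negbK.
rewrite prodf_seq_eq0 => /hasP[y yr /= /eqP dety]; exists y.
  rewrite -eigenvalue_root_char /eigenvalue /eigenspace kermx_eq0 row_free_unit.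
  rewrite unitmxE -(_ : horner_mx A ('X - y%:P) = A - y%:M) ?dety ?unitr0//.
  by rewrite rmorphB /= horner_mx_X horner_mx_C.
have : root (p - z%:P) y by rewrite rE rootZ ?lead_coef_eq0// root_prod_XsubC.
by rewrite /root hornerD hornerN hornerC subr_eq0 => /eqP.
Qed.

End SpectralMapping.

Section NormC.
Variable R : realType.
Local Notation N := (@ComplexField.Normc.normc R).

Lemma normc_ge0 z : 0 <= N z. Proof. by case: z => a b; exact: sqrtr_ge0. Qed.

Lemma normcX z n : N (z ^+ n) = N z ^+ n.
Proof.
elim: n => [|n ih]; first exact: ComplexField.Normc.normc1.
by rewrite !exprS ComplexField.Normc.normcM ih.
Qed.

Lemma normcN z : N (- z) = N z.
Proof. by case: z => a b /=; rewrite !sqrrN. Qed.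

Lemma normc_int (k : int) : N k%:~R = `|k|%:~R.
Proof.
rewrite -(rmorph_int (real_complex R)) /= expr0n addr0 sqrtr_sqr.
by rewrite intr_norm.
Qed.

Lemma normcD z w : N (z + w) <= N z + N w.
Proof. exact: le_normcD. Qed.

Lemma normc_eq0 z : (N z == 0) = (z == 0).
Proof.
apply/eqP/eqP => [|->]; first exact: ComplexField.Normc.eq0_normc.
exact: ComplexField.Normc.normc0.
Qed.

Lemma normc_sum I (s : seq I) (P : pred I) (F : I -> R[i]) :
  N (\sum_(i <- s | P i) F i) <= \sum_(i <- s | P i) N (F i).
Proof.
apply: (big_ind2 (fun z t => N z <= t)) => //.
- by rewrite ComplexField.Normc.normc0.
- by move=> z t w u zt wu; rewrite (le_trans (normcD _ _))// lerD.
Qed.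

Lemma coef_prod_bound (s : seq R[i]) (t : R) i : 0 <= t ->
  (forall z, z \in s -> N z <= t) ->
  N (\prod_(z <- s) ('X - z%:P))`_i <= (1 + t) ^+ size s.
Proof.
move=> t0; elim: s i => [|z s ih] i hs.
  rewrite big_nil coef1; case: (i == _); rewrite ?ComplexField.Normc.normc1//.
  by rewrite ComplexField.Normc.normc0 ler01.
have {}ih j : N (\prod_(z <- s) ('X - z%:P))`_j <= (1 + t) ^+ size s.
  by apply: ih => w ws; apply: hs; rewrite inE ws orbT.
rewrite big_cons mulrBl coefB coefXM coefCM (le_trans (normcD _ _))// normcN.
rewrite ComplexField.Normc.normcM exprS mulrDl mul1r lerD//.
  by case: ifP => // _; rewrite ComplexField.Normc.normc0 exprn_ge0// addr_ge0.
by rewrite ler_pM ?normc_ge0// hs ?mem_head.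
Qed.

End NormC.

(** * Kronecker's theorem with a gap, and embeddings of number fields *)

Section Kronecker.
Variable R : realType.
Local Notation N := (@ComplexField.Normc.normc R).
Local Notation pC := (map_poly (intr : int -> R[i])).

Let pC_neq0 (p : {poly int}) : p != 0 -> pC p != 0.
Proof. by move=> p0; rewrite map_poly_eq0_id0// intr_eq0 lead_coef_eq0. Qed.

(** The integral polynomials of degree at most [B] with coefficients between [-X]
    and [X], indexed by a finite type. *)
Definition box_poly (B X : nat) (f : {ffun 'I_B.+1 -> 'I_(X.*2.+1)}) : {poly int} :=
  \poly_(i < B.+1) ((f (inord i) : nat)%:Z - X%:Z).

Lemma box_polyP (B X : nat) (p : {poly int}) : (size p <= B.+1)%N ->
  (forall i, (absz (p`_i)%R <= X)%N) ->
  exists f : {ffun 'I_B.+1 -> 'I_(X.*2.+1)}, p = box_poly f.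
Proof.
move=> sp pX; exists [ffun i : 'I_B.+1 => inord (absz (p`_i + X%:Z))].
apply/polyP => i; rewrite coef_poly; case: ltnP => iB; last first.
  by rewrite nth_default// (leq_trans sp).
have h0 : 0 <= p`_i + X%:Z.
  by rewrite -lerBlDr sub0r lerNl (le_trans (ler_norm _))// normrN -abszE lez_nat.
rewrite ffunE !inordK//; first by rewrite gez0_abs// addrK.
rewrite ltnS -lez_nat gez0_abs// -addnn PoszD lerD2r.
by rewrite (le_trans (ler_norm _))// -abszE lez_nat.
Qed.

Lemma monic_int_coef_bound (B k : nat) (p : {poly int}) i : p \is monic ->
  (size p <= B.+1)%N -> (forall z, root (pC p) z -> N z <= k%:R) ->
  (absz (p`_i)%R <= k.+1 ^ B)%N.
Proof.
move=> mon_p sp hroots.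
have [r rE] := closed_field_poly_normal (pC p).
have mon_pC : pC p \is monic by rewrite monic_map.
have {}rE : pC p = \prod_(z <- r) ('X - z%:P) by rewrite rE (monicP mon_pC) scale1r.
have szr : (size r <= B)%N.
  move: sp; rewrite -(size_map_poly_id0 (f := intr : int -> R[i])).
    by rewrite rE size_prod_XsubC.
  by rewrite intr_eq0 (monicP mon_p).
rewrite -(ler_nat R).
have -> : (absz p`_i)%:R = N (pC p)`_i by rewrite coef_map /= normc_int pmulrn abszE.
rewrite rE (le_trans (@coef_prod_bound _ r k%:R i _ _))//.
  by move=> z zr; apply: hroots; rewrite rE root_prod_XsubC.
by rewrite natrX -nat1r; apply: ler_weXn2l => //; rewrite lerDl.
Qed.

(** The powers of [z] are roots of the characteristic polynomials of the powers
    of a companion matrix of [p]. These polynomials are integral, with roots in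
    the unit disc, so there are finitely many of them, and two powers of [z]
    coincide. *)
Lemma kronecker (p : {poly int}) : p \is monic ->
  (forall z, root (pC p) z -> N z <= 1) ->
  forall z, root (pC p) z -> z != 0 -> exists2 m, (0 < m)%N & z ^+ m = 1.
Proof.
move=> mon_p hroots z pz z0.
have sp1 : (1 < size p)%N.
  rewrite ltnNge; apply/negP => sp; move: pz.
  have : p = 1.
    rewrite (size1_polyC sp); congr _%:P; rewrite -(monicP mon_p) /lead_coef.
    by move: sp mon_p; case: (size p) => [|[]].
  by move=> ->; rewrite rmorph1 (negPf (root1 _)).
have [n [A AE]] := char_poly_exists mon_p sp1.
pose AC := map_mx (intr : int -> R[i]) A.
have powE k : pC (char_poly (A ^+ k)) = char_poly (horner_mx AC 'X^k).
  by rewrite map_char_poly !rmorphXn /= horner_mx_X.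
have ACE : char_poly AC = pC p by rewrite -map_char_poly AE.
pose X := (2 ^ n.+1)%N.
have /choice[f fE] : forall k, exists f : {ffun 'I_n.+2 -> 'I_(X.*2.+1)},
    char_poly (A ^+ k) = box_poly f.
  move=> k; apply: box_polyP; first by rewrite size_char_poly.
  move=> i; apply: (@monic_int_coef_bound n.+1 1); rewrite ?char_poly_monic ?size_char_poly//.
  move=> w; rewrite powE => /char_poly_horner_root[r]; rewrite ACE => /hroots hr <-.
  by rewrite hornerXn normcX exprn_ile1// normc_ge0.
pose roots (g : {ffun 'I_n.+2 -> 'I_(X.*2.+1)}) : seq R[i] :=
  sval (closed_field_poly_normal (pC (box_poly g))).
pose S := flatten [seq roots g | g : {ffun 'I_n.+2 -> 'I_(X.*2.+1)}].
have zS k : z ^+ k \in S.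
  apply/flattenP; exists (roots (f k)); first by apply/mapP; exists (f k); rewrite ?mem_enum.
  have : root (pC (box_poly (f k))) (z ^+ k).
    by rewrite -fE powE -hornerXn root_char_poly_horner// ACE.
  rewrite /roots; case: closed_field_poly_normal => r /= {1}->.
  rewrite rootZ ?root_prod_XsubC// lead_coef_eq0 pC_neq0// -fE.
  by rewrite monic_neq0// char_poly_monic.
have [i [j [ij zij]]] := values_collide zS.
exists (j - i)%N; first by rewrite subn_gt0.
by rewrite exprB ?unitfE ?(ltnW ij)// -zij mulfV// expf_neq0.
Qed.

(** Only finitely many integral polynomials of bounded degree have all their
    roots in the disc of radius 2. So those with a root outside the unit disc
    have one at a distance bounded below, and the exponents given by
    Kronecker's theorem for the others have a common multiple. *)
Lemma kronecker_gap (B : nat) : exists (M : nat) (eps : R), [/\ (0 < M)%N, 0 < eps &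
  forall p : {poly int}, p \is monic -> (size p <= B.+1)%N ->
    (forall z, root (pC p) z -> N z < 1 + eps) ->
    forall z, root (pC p) z -> z != 0 -> z ^+ M = 1].
Proof.
pose X := (3 ^ B)%N; pose T := {ffun 'I_B.+1 -> 'I_(X.*2.+1)}.
have one (g : T) : exists Me : nat * R, [/\ (0 < Me.1)%N, 0 < Me.2 & box_poly g \is monic ->
    (forall z, root (pC (box_poly g)) z -> N z < 1 + Me.2) ->
    forall z, root (pC (box_poly g)) z -> z != 0 -> z ^+ Me.1 = 1].
  have [mon_g|nmon_g] := boolP (box_poly g \is monic); last by exists (1%N, 1); split.
  have [le1|] := pselect (forall z, root (pC (box_poly g)) z -> N z <= 1); last first.
    move=> /existsNP[z /not_implyP[gz /negP]]; rewrite -ltNge => Nz.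
    exists (1%N, N z - 1); split; rewrite ?subr_gt0//= => _ /(_ z gz).
    by rewrite addrC subrK ltxx.
  have /choice[m hm] : forall z, exists m, (0 < m)%N /\
      (root (pC (box_poly g)) z -> z != 0 -> z ^+ m = 1).
    move=> z; have [[gz z0]|no] := pselect (root (pC (box_poly g)) z /\ z != 0).
      by have [m m0 zm] := kronecker mon_g le1 gz z0; exists m.
    by exists 1%N; split=> // gz z0; case: no.
  have [r rE] := closed_field_poly_normal (pC (box_poly g)).
  exists ((\prod_(z <- r) m z)%N, 1); split=> //=.
    by apply: prodn_gt0 => z; case: (hm z).
  move=> _ _ z gz z0.
  have zr : z \in r.
    by move: gz; rewrite rE rootZ ?root_prod_XsubC// lead_coef_eq0 pC_neq0// monic_neq0.
  by rewrite (big_rem z zr) /= exprM (hm z).2// expr1n.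
have /choice[Me hMe] := one.
exists (\prod_(g : T) (Me g).1)%N, (\big[Num.min/1]_(g : T) (Me g).2); split.
- by apply: prodn_gt0 => g; case: (hMe g).
- by apply: lt_bigmin => // g _; case: (hMe g).
move=> p mon_p sp hroots z pz z0.
have roots2 w : root (pC p) w -> N w <= 2.
  move=> /hroots/ltW/le_trans; apply.
  by rewrite [leRHS](_ : _ = 1 + 1)// lerD2l bigmin_le_id.
have [g gE] : exists g : T, p = box_poly g.
  by apply: box_polyP => // i; exact: (@monic_int_coef_bound B 2).
have [_ _ hg] := hMe g; rewrite (bigD1 g)//= exprM hg ?expr1n -?gE// => w /hroots.
by move=> /lt_le_trans; apply; rewrite lerD2l; exact: bigmin_le_cond.
Qed.

End Kronecker.

Section PrescribedEmbedding.

(** Write [L = Q(theta)] and [gamma] as a polynomial in [theta]. The conjugates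
    of [gamma] are eigenvalues of this polynomial in a companion matrix of
    [theta], hence its values at conjugates of [theta], and [theta] can be sent
    to any of its conjugates. *)
Lemma embedding_exists (L : fieldExtType rat) (F : numClosedFieldType)
    (gamma : L) (f : {poly rat}) (z : F) :
  (forall q, root (map_poly (in_alg L) q) gamma -> f %| q) ->
  root (map_poly ratr f) z -> exists s : {rmorphism L -> F}, s gamma = z.
Proof.
move=> minf fz.
have [theta gen] := number_field_generator L.
have [g [mon_g _ gtheta ming]] := rational_minPoly theta.
have /choice[q qE] := gen.
have sg : (1 < size g)%N.
  rewrite -(size_map_poly (in_alg L)); apply: root_size_gt1 gtheta.
  by rewrite map_poly_eq0 monic_neq0.
have [n [A AE]] := char_poly_exists mon_g sg.
pose chi := char_poly (horner_mx A (q gamma)).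
have chi_gamma : root (map_poly (in_alg L) chi) gamma.
  rewrite map_char_poly map_horner_mx {2}(qE gamma) root_char_poly_horner//.
  by rewrite -map_char_poly AE.
have chi_z : root (map_poly ratr chi : {poly F}) z.
  have /dvdpP[h ->] := minf _ chi_gamma.
  by rewrite rmorphM /= rootM fz orbT.
have [r gr qr] : exists2 r : F, root (map_poly ratr g) r & (map_poly ratr (q gamma)).[r] = z.
  move: chi_z; rewrite map_char_poly map_horner_mx => /char_poly_horner_root[r].
  by rewrite -map_char_poly AE; exists r.
pose s x : F := (map_poly ratr (q x)).[r].
have wd (p1 p2 : {poly rat}) :
    (map_poly (in_alg L) p1).[theta] = (map_poly (in_alg L) p2).[theta] ->
    (map_poly ratr p1).[r] = (map_poly ratr p2).[r] :> F.
  move=> p12; apply/eqP; rewrite -subr_eq0 -hornerN -hornerD -rmorphN -rmorphD /=.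
  have /dvdpP[h ->] : g %| p1 - p2.
    by apply: ming; rewrite /root rmorphB /= hornerD hornerN p12 subrr.
  by rewrite rmorphM /= -/(root _ _) rootM gr orbT.
have [||s' s'E] := @rmorphism_exists L F s.
- move=> x y; rewrite /s -hornerN -hornerD -rmorphN -rmorphD /=; apply: wd.
  by rewrite -qE rmorphB /= hornerD hornerN -!qE.
- split=> [|x y]; rewrite /s.
    by rewrite (wd _ 1) ?rmorph1 ?hornerC// -qE.
  by rewrite -hornerM -rmorphM /=; apply: wd; rewrite -qE rmorphM /= hornerM -!qE.
by exists s'; rewrite s'E.
Qed.

End PrescribedEmbedding.

(** * The field generated by a pair of eigenvalues *)

Section EigenvalueField.

Lemma dim_image_rmorph (K L : fieldExtType rat) (j : {rmorphism K -> L}) :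
  exists E : {subfield L}, (forall x, j x \in E) /\ (\dim E <= \dim {:K})%N.
Proof.
pose jl : {linear K -> L} := HB.pack (j : K -> L)
  (GRing.isZmodMorphism.Build K L j (rmorphB j))
  (GRing.isScalable.Build rat K L *:%R j (fmorph_numZ j)).
have jE x : linfun jl x = j x by rewrite lfunE.
have jM : ahom_in {:K} (linfun jl).
  by apply/ahomP_tmp; split=> [|x y]; rewrite !jE ?rmorph1 ?rmorphM.
exists (AHom jM @: {:K})%AS; split=> [x|].
  by rewrite -jE; apply/memv_img/memvf.
by rewrite -(limg_ker_dim (linfun jl) {:K}) leq_addl.
Qed.

Lemma dim_Fadjoin_le (L : fieldExtType rat) (E : {subfield L}) (x : L) (p : {poly L}) n :
  p != 0 -> p \is a polyOver E -> root p x -> (size p <= n.+1)%N ->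
  (\dim <<E; x>> <= n * \dim E)%N.
Proof.
move=> p0 pE px sp; rewrite dim_Fadjoin leq_pmul2r ?adim_gt0//.
rewrite -ltnS -size_minPoly (leq_trans _ sp)//; apply: dvdp_leq => //.
exact: minPoly_dvdp.
Qed.

(** The bound on the degree of the field [K(lam, mu)] is what makes the constants
    uniform in the matrices that have [lam] and [mu] as eigenvalues. *)
Lemma root_field (K : fieldExtType rat) (iota : {rmorphism K -> algC}) (n : nat)
    (p q : {poly K}) (lam mu : algC) :
  p != 0 -> q != 0 -> (size p <= n.+1)%N -> (size q <= n.+1)%N ->
  root (map_poly iota p) lam -> root (map_poly iota q) mu ->
  exists (L : fieldExtType rat) (LC : {rmorphism L -> algC})
         (j : {rmorphism K -> L}) (l m : L),
    [/\ forall x, LC (j x) = iota x, LC l = lam, LC m = mu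
      & (\dim {:L} <= n * (n * \dim {:K}))%N].
Proof.
move=> p0 q0 sp sq plam qmu.
pose bK := vbasis {:K}.
have [L [LC [s1 s1E gen]]] := num_field_exists [:: lam, mu & [seq iota b | b <- bK]].
case: s1 s1E gen => // l [//|m bs] [lE mE bsE] gen.
have /choice[j jE] : forall x, exists y, LC y = iota x.
  move=> x; exists (\sum_i coord bK i x *: bs`_i).
  rewrite rmorph_sum /= {2}(coord_vbasis (memvf x)) rmorph_sum; apply: eq_bigr => i _.
  rewrite !rmorphZ_num; congr (_ * _).
  have sz : (i < size bs)%N by rewrite -(size_map LC) bsE size_map size_tuple.
  by rewrite -(nth_map _ 0) // bsE (nth_map 0) // size_tuple.
have LCI := fmorph_inj LC.
have [||j' j'E] := @rmorphism_exists K L j.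
- by move=> x y; apply: LCI; rewrite rmorphB /= !jE rmorphB.
- by split=> [|x y]; apply: LCI; rewrite ?rmorphM/= !jE ?rmorph1 ?rmorphM.
have LCj x : LC (j' x) = iota x by rewrite j'E jE.
exists L, LC, j', l, m; split=> //.
have [E [jin dE]] := dim_image_rmorph j'.
have overE (r : {poly K}) : map_poly j' r \is a polyOver E.
  by apply/polyOverP => i; rewrite coef_map; apply: jin.
have rootL (r : {poly K}) x : root (map_poly iota r) (LC x) -> root (map_poly j' r) x.
  have -> : map_poly iota r = map_poly LC (map_poly j' r).
    by rewrite -map_poly_comp; apply: eq_map_poly => t; rewrite /= LCj.
  by rewrite fmorph_root.
have E1 := @dim_Fadjoin_le L E l (map_poly j' p) n.
have E2 := @dim_Fadjoin_le L <<E; l>>%AS m (map_poly j' q) n.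
apply: (@leq_trans (\dim <<<<E; l>>; m>>)).
  apply: dimvS; rewrite -gen; apply/Fadjoin_seqP; split; first exact: sub1v.
  move=> x; rewrite !inE => /or3P[/eqP->|/eqP->|xbs].
  - by apply: subvP_adjoin; apply: memv_adjoin.
  - exact: memv_adjoin.
  - have [b _ xb] : exists2 b, b \in bK & LC x = iota b.
      by apply/mapP; rewrite -bsE map_f.
    by rewrite (_ : x = j' b); [apply/subvP_adjoin/subvP_adjoin/jin|apply: LCI; rewrite LCj].
apply: (leq_trans (E2 _ _ _ _)).
- by rewrite map_poly_eq0.
- by apply: polyOverS (overE q) => x; apply: subvP_adjoin.
- by apply: rootL; rewrite mE.
- by rewrite size_map_poly.
rewrite leq_mul2l; apply/orP; right; apply: (leq_trans (E1 _ _ _ _)) => //.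
- by rewrite map_poly_eq0.
- by apply: rootL; rewrite lE.
- by rewrite size_map_poly.
by rewrite leq_mul2l dE orbT.
Qed.

End EigenvalueField.

(** * Roots of eigenvalues: integral and nonintegral elements *)

Section IntegralMinPoly.

(** By Gauss's lemma [f] is a constant times an integral factor of [g]; that
    constant is an integer, since the leading coefficient of the factor divides
    the leading coefficient 1 of [g]. *)
Lemma monic_int_factor (f : {poly rat}) (g : {poly int}) :
  f \is monic -> g \is monic -> f %| map_poly intr g ->
  exists2 p : {poly int}, p \is monic & f = map_poly intr p.
Proof.
move=> mon_f mon_g /dvdpP_rat_int[p [a a0 fE]] [r gE].
have lcg : lead_coef p * lead_coef r = 1 by rewrite -lead_coefM -gE (monicP mon_g).
have lcf : a * (lead_coef p)%:~R = 1.
  rewrite -[RHS](monicP mon_f) fE lead_coefZ lead_coef_map_inj//.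
  exact: intr_inj.
have aE : a = (lead_coef r)%:~R.
  apply: (mulIf (_ : (lead_coef p)%:~R != 0)); last by rewrite lcf -intrM mulrC lcg.
  by apply: contra_eq_neq lcf => ->; rewrite mulr0 eq_sym oner_eq0.
exists (lead_coef r *: p); first by apply/monicP; rewrite lead_coefZ mulrC.
by rewrite fE aE map_polyZ.
Qed.

Variable L : fieldExtType rat.

Lemma integral_minPoly (x : L) : integral_over_int x ->
  exists (f : {poly rat}) (p : {poly int}), [/\ p \is monic, f = map_poly intr p,
    (size p <= (\dim {:L}).+1)%N, root (map_poly (in_alg L) f) x
    & forall q : {poly rat}, root (map_poly (in_alg L) q) x -> f %| q].
Proof.
move=> [g mon_g gx]; have [f [mon_f sf fx minf]] := rational_minPoly x.
have [|p mon_p fE] := monic_int_factor mon_f mon_g.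
  apply: minf; rewrite -map_poly_comp; move: gx; congr (root _ _).
  by apply: eq_map_poly => k; rewrite /= -in_algE rmorph_int.
exists f, p; split=> //; move: sf; rewrite fE size_map_poly_id0//.
by rewrite intr_eq0 (monicP mon_p).
Qed.

End IntegralMinPoly.

Section Gap.
Variables (R : realType) (B M : nat) (eps : R).
Local Notation N := (@ComplexField.Normc.normc R).
Hypothesis eps0 : 0 < eps.
Hypothesis gap : forall p : {poly int}, p \is monic -> (size p <= B.+1)%N ->
    (forall z : R[i], root (map_poly intr p) z -> N z < 1 + eps) ->
    forall z : R[i], root (map_poly intr p) z -> z != 0 -> z ^+ M = 1.
Variable L : fieldExtType rat.
Hypothesis dimL : (\dim {:L} <= B)%N.

Let ratr_intr (p : {poly int}) :
  map_poly ratr (map_poly intr p : {poly rat}) = map_poly intr p :> {poly R[i]}.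
Proof. by rewrite -map_poly_comp; apply: eq_map_poly => k; rewrite /= ratr_int. Qed.

(** If all conjugates of [x] were small, the gap would make one of them, hence
    [x] itself, a root of unity of order dividing [M]. *)
Lemma large_conjugate (x : L) : x != 0 -> integral_over_int x -> x ^+ M != 1 ->
  exists s : {rmorphism L -> R[i]}, 1 + eps <= N (s x).
Proof.
move=> x0 /integral_minPoly[f [p [mon_p fE sp fx minf]]] xM.
apply: contrapT => no; move/eqP: xM; apply.
have conj z : root (map_poly intr p) z -> exists s : {rmorphism L -> R[i]}, s x = z.
  by move=> pz; apply: (embedding_exists minf); rewrite fE ratr_intr.
have small z : root (map_poly intr p) z -> N z < 1 + eps.
  move=> /conj[s sx]; rewrite ltNge; apply/negP => h; apply: no.
  by exists s; rewrite sx.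
have [z pz] : exists z : R[i], root (map_poly intr p) z.
  apply/closed_rootP; rewrite -ratr_intr -fE size_map_poly -(size_map_poly (in_alg L)).
  rewrite neq_ltn (root_size_gt1 _ fx) ?orbT//.
  by rewrite map_poly_eq0 fE monic_neq0// monic_map.
have [s sx] := conj z pz.
apply: (fmorph_inj s); rewrite rmorphXn rmorph1 /= sx.
apply: (gap mon_p _ small pz); first by rewrite (leq_trans sp).
by rewrite -sx fmorph_eq0.
Qed.

(** All conjugates of a root of unity have absolute value 1. *)
Lemma torsion_exponent (x : L) k : (0 < k)%N -> x ^+ k = 1 -> x ^+ M = 1.
Proof.
move=> k0 xk; have x0 : x != 0.
  by apply: contra_eq_neq xk => ->; rewrite expr0n gtn_eqF// eq_sym oner_eq0.
apply: contrapT => /eqP xM.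
have [|s] := large_conjugate x0 _ xM.
  exists ('X^k - 1); first exact: monicXnsubC.
  by rewrite /root rmorphB /= map_polyXn rmorph1 !hornerE xk subrr.
have : N (s x) ^+ k = 1.
  by rewrite -normcX -rmorphXn xk rmorph1 ComplexField.Normc.normc1.
move/eqP; rewrite pexprn_eq1 ?normc_ge0// gtn_eqF//= => /eqP ->.
by rewrite gerDl leNgt eps0.
Qed.

End Gap.

Section EigenvalueBounds.

(** Compare absolute values at a largest coordinate of an eigenvector. *)
Lemma normc_eigenvalue (R : realType) n (A : 'M[R[i]]_n) (l : R[i]) (t : R) :
  (forall i j, ComplexField.Normc.normc (A i j) <= t) ->
  eigenvalue A l -> ComplexField.Normc.normc l <= n%:R * t.
Proof.
move=> At /eigenvalueP[v vA v0].
have [i0 vi0] : exists i, v 0 i != 0 by move/rV0Pn: v0.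
have t0 : 0 <= t by rewrite (le_trans (normc_ge0 (A i0 i0))).
have [i _ maxi] := @arg_maxP _ _ _ i0 xpredT (fun i => ComplexField.Normc.normc (v 0 i)) isT.
have vi : 0 < ComplexField.Normc.normc (v 0 i).
  by rewrite (lt_le_trans _ (maxi i0 isT))// lt_neqAle normc_ge0 andbT eq_sym normc_eq0.
rewrite -(ler_pM2r vi) -ComplexField.Normc.normcM.
have -> : l * v 0 i = \sum_k v 0 k * A k i.
  by have := congr1 (fun w : 'rV_n => w 0 i) vA; rewrite !mxE => <-.
rewrite (le_trans (normc_sum _ _ _))//.
apply: (@le_trans _ _ (\sum_(k < n) t * ComplexField.Normc.normc (v 0 i))).
  apply: ler_sum => k _; rewrite ComplexField.Normc.normcM mulrC.
  by rewrite ler_pM ?normc_ge0//; exact: maxi.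
by rewrite sumr_const card_ord -[leLHS]mulr_natl mulrA.
Qed.

(** As in the archimedean case, compare at a largest coordinate of an
    eigenvector. *)
Lemma valuation_eigenvalue (L : fieldType) (V : set L) n (A : 'M[L]_n) (l t : L) :
  valuation_ring V -> t != 0 -> (forall i j, V (A i j / t)) ->
  eigenvalue A l -> V (l / t).
Proof.
move=> hV t0 At /eigenvalueP[v vA v0].
have [i0 vi0] : exists i, v 0 i != 0 by move/rV0Pn: v0.
have [||y ys hy] := @most_divisible _ V hV [seq x <- [seq v 0 i | i : 'I_n] | x != 0].
- rewrite -has_filter; apply/hasP; exists (v 0 i0) => //.
  by apply/mapP; exists i0; rewrite ?mem_enum.
- exact: filter_all.
move: ys; rewrite mem_filter => /andP[y0 /mapP[i _ yE]].
rewrite (_ : l / t = \sum_k (v 0 k / y) * (A k i / t)).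
  apply: (subring_sum (proj1 hV)) => k _; apply: (subringM (proj1 hV)) => //.
  have [->|vk] := eqVneq (v 0 k) 0; first by rewrite mul0r; apply: subring0 (proj1 hV).
  by apply: hy; rewrite mem_filter vk; apply/mapP; exists k; rewrite ?mem_enum.
have := congr1 (fun w : 'rV_n => w 0 i / y / t) vA; rewrite !mxE -yE mulfK// => <-.
by rewrite !mulr_suml; apply: eq_bigr => k _; rewrite !mulrA; congr (_ / _); rewrite mulrAC.
Qed.

End EigenvalueBounds.

Section MultiplicativeBound.
Variables (R : realType) (K L : fieldExtType rat) (j : {rmorphism K -> L}).
Variables (n : nat) (A : 'M[K]_n) (l x : L) (b g : nat).
Hypotheses (Al : eigenvalue (map_mx j A) l) (g0 : (0 < g)%N)
  (lx : l ^+ g = x ^+ (b * g)).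

Let h := mx_height R A ^+ \dim {:K}.

(** Let [V] be a valuation ring of [L] without [x], and [v] the place of [K]
    below it. In a rational equation of degree at most [B] for [x] two terms are
    associated, so some [x^e] with [0 < e <= B] is a rational number [z] up to a
    unit of [V]. As [z] is not integral at [v], its value is at least 2. On the
    other hand [l] is at most as large as the largest entry [t] of [A], so that
    [l^(e g) = x^(e b g)] gives [v(z)^b <= v(t)^e]. *)
Lemma nonintegral_bound B : (\dim {:L} <= B)%N -> ~ integral_over_int x -> 2 ^+ b <= h ^+ B.
Proof.
move=> dimL /nonintegral_valuation_ring[V hV nVx]; have sV := proj1 hV.
have x0 : x != 0 by apply/eqP => x0; apply: nVx; rewrite x0; apply: subring0.
have [f [mon_f sf fx _]] := rational_minPoly x.
pose F (i : 'I_(size f)) := (f`_i)%:A * x ^+ i.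
have sumF : \sum_i F i = 0.
  rewrite -[RHS](rootP fx) (horner_coef_wide _ (_ : (_ <= size f)%N)) ?size_map_poly//.
  by apply: eq_bigr => i _; rewrite coef_map.
have sf0 : (0 < size f)%N by rewrite size_poly_gt0 monic_neq0.
have top_lt : ((size f).-1 < size f)%N by rewrite prednK.
have Ftop : F (Ordinal top_lt) != 0.
  rewrite /F /= -/(lead_coef f) (monicP mon_f) scale1r mul1r.
  exact: expf_neq0.
have [i1 [i2 [i12 F1 F2 V12 V21]]] := two_dominant_terms hV sumF Ftop.
have [e [z [e0 eB z0 Vxz Vzx]]] : exists (e : nat) (z : rat), [/\ (0 < e)%N, (e <= B)%N,
    z != 0, V (x ^+ e / z%:A) & V (z%:A / x ^+ e)].
  wlog lt21 : i1 i2 {i12} F1 F2 V12 V21 / (i2 < i1)%N => [wl|].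
    have [lt|lt|/val_inj/eqP] := ltngtP i1 i2; last by rewrite (negPf i12).
      exact: (wl i2 i1).
    exact: (wl i1 i2).
  have f1 : f`_i1 != 0 by apply: contra_neq F1 => h0; rewrite /F h0 scale0r mul0r.
  have f2 : f`_i2 != 0 by apply: contra_neq F2 => h0; rewrite /F h0 scale0r mul0r.
  exists (i1 - i2)%N, (f`_i2 / f`_i1); rewrite subn_gt0 mulf_neq0 ?invr_neq0//.
  have FE : F i1 / F i2 = x ^+ (i1 - i2) / (f`_i2 / f`_i1)%:A.
    have a1 : in_alg L f`_i1 != 0 by rewrite fmorph_eq0.
    have a2 : in_alg L f`_i2 != 0 by rewrite fmorph_eq0.
    rewrite /F -!in_algE fmorph_div exprB ?unitfE ?(ltnW lt21)//.
    have x2 : x ^+ i2 != 0 by rewrite expf_neq0.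
    by field; rewrite a1 a2 x2.
  split=> //; last 2 first.
  - by rewrite -FE.
  - by rewrite -invf_div -FE invf_div.
  rewrite (leq_trans (leq_subr _ _))// (leq_trans _ dimL)// -ltnS.
  exact: leq_trans (ltn_ord i1) sf.
pose W : set K := [set k | V (j k)].
have hW : valuation_ring W.
  split; last by move=> k; rewrite /W /= fmorphV; exact: hV.2.
  split=> [|k1 k2|k1 k2]; rewrite /W /= ?rmorph1 ?rmorphB ?rmorphM.
  - exact: subring1.
  - exact: subringB.
  - exact: subringM.
pose zK : K := z%:A.
have jz : j zK = z%:A by rewrite /zK fmorph_numZ rmorph1.
have nWz : ~ W zK.
  move=> Wz; apply: nVx; rewrite -(prednK e0) in Vxz.
  apply: (valuation_rootX hV (n := e.-1)).
  rewrite -(mulfVK (_ : (z%:A : L) != 0) (x ^+ _)); last by rewrite -in_algE fmorph_eq0.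
  by apply: subringM => //; rewrite -jz.
have [v hv vW] := place_of_valuation_ring R hW (ex_intro _ zK nWz).
have vz : 2 <= v zK.
  by apply: place_ge2 => //; rewrite ltNge; apply/negP => /vW.
pose entries := 1 :: [seq c <- [seq A p.1 p.2 | p : 'I_n * 'I_n] | c != 0].
have [||t tin ht] := @most_divisible _ W hW entries => //.
  by rewrite /= oner_eq0 /=; exact: filter_all.
have t0 : t != 0.
  by move: tin; rewrite inE => /predU1P[->|]; rewrite ?oner_eq0// mem_filter => /andP[].
have h1 : 1 <= h by exact: mx_height_ge1.
have vt : v t <= h.
  move: tin; rewrite inE => /predU1P[->|]; first by rewrite place1.
  by rewrite mem_filter => /andP[_ /mapP[p _ ->]]; exact: mx_height_place.
have jt0 : j t != 0 by rewrite fmorph_eq0.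
have Vlt : V (l / j t).
  apply: valuation_eigenvalue hV jt0 _ Al => i k; rewrite mxE -fmorph_div.
  have [->|Aik] := eqVneq (A i k) 0; first by rewrite mul0r rmorph0; exact: subring0.
  apply: (ht (A i k)); rewrite inE mem_filter Aik; apply/orP; right.
  by apply/mapP; exists (i, k); rewrite ?mem_enum.
have Wzt : W (zK ^+ (b * g) / t ^+ (e * g)).
  rewrite /W /= rmorphM fmorphV !rmorphXn /= jz.
  rewrite (_ : _ / _ = (z%:A / x ^+ e) ^+ (b * g) * (l / j t) ^+ (e * g)).
    by apply: subringM => //; apply: subringX.
  have lE : l ^+ (e * g) = x ^+ (b * g * e) by rewrite mulnC exprM lx -exprM.
  rewrite [(l / _) ^+ _]expr_div_n lE.
  rewrite [(_ / x ^+ e) ^+ _]expr_div_n -[(x ^+ e) ^+ _]exprM.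
  have -> : (e * (b * g) = b * g * e)%N by rewrite mulnC.
  by rewrite mulrA mulfVK// expf_neq0.
have vzt : v zK ^+ b <= v t ^+ e.
  rewrite -(ler_pXn2r g0) ?nnegrE ?exprn_ge0 ?place_ge0// -!exprM.
  move/vW: Wzt; rewrite placeM// placeV// !placeX// ler_pdivrMr ?mul1r//.
  by rewrite exprn_gt0// place_gt0.
apply: (@le_trans _ _ (v zK ^+ b)).
  by rewrite lerXn2r ?nnegrE ?place_ge0.
rewrite (le_trans vzt)// (@le_trans _ _ (h ^+ e))//.
  by rewrite lerXn2r ?nnegrE ?place_ge0// (le_trans ler01).
exact: ler_weXn2l.
Qed.

Lemma integral_bound (s : {rmorphism L -> R[i]}) :
  ComplexField.Normc.normc (s x) ^+ b <= n%:R * h.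
Proof.
have sl : ComplexField.Normc.normc (s l) <= n%:R * h.
  apply: (@normc_eigenvalue R n (map_mx s (map_mx j A))).
    move=> i k; rewrite !mxE; exact: (mx_height_embedding A (s \o j)).
  by rewrite eigenvalue_root_char -map_char_poly fmorph_root -eigenvalue_root_char.
apply: le_trans sl; rewrite -(ler_pXn2r g0) ?nnegrE ?exprn_ge0 ?normc_ge0//.
by rewrite -exprM -!normcX -!rmorphXn lx.
Qed.

End MultiplicativeBound.

(** * Relations between two eigenvalues *)

Section EigenvaluePairs.
Variables (R : realType) (K : fieldExtType rat) (n : nat).

(** The first part is the uniform bound on roots of unity in [K(lam, mu)]. For
    the second, choose [u a + w b = 1] and put [gam = lam^w mu^u]. Then [gam^b]
    equals [lam] up to a root of unity, so [lam] is essentially a [b]-th power.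
    If [gam] is an algebraic integer, it has a conjugate of absolute value at
    least [1 + eps]; otherwise it has a pole. In both cases its [b]-th power is
    too large for an eigenvalue of [A1], unless [b] is small. *)
Lemma eigenvalue_pairs : exists (M B : nat) (del : R), [/\ (0 < M)%N, 0 < del &
  forall (iota : {rmorphism K -> algC}) (A1 A2 : 'M[K]_n.+1) (lam mu : algC),
    lam != 0 -> mu != 0 ->
    eigenvalue (map_mx iota A1) lam -> eigenvalue (map_mx iota A2) mu ->
  [/\ forall (a b : int) g, (0 < g)%N -> (lam ^ a / mu ^ b) ^+ g = 1 ->
         (lam ^ a / mu ^ b) ^+ M = 1
    & forall (a b : int) g, coprimez a b -> b != 0 -> (0 < g)%N ->
         (lam ^ a / mu ^ b) ^+ g = 1 -> lam ^+ M != 1 ->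
         (1 + del) ^+ `|b|%N <= n.+1%:R * (mx_height R A1 ^+ \dim {:K}) ^+ B]].
Proof.
pose B := (n.+1 * (n.+1 * \dim {:K}))%N.
have [M [eps [M0 eps0 gap]]] := kronecker_gap R B.
exists M, B, (Num.min eps 1); split; rewrite ?lt_min ?eps0 ?ltr01//.
move=> iota A1 A2 lam mu lam0 mu0 A1lam A2mu.
have cp0 (A : 'M[K]_n.+1) : char_poly A != 0 by rewrite monic_neq0// char_poly_monic.
have [||||||L [LC [j [l [m [LCj LCl LCm dimL]]]]]] :=
  @root_field K iota n.+1 (char_poly A1) (char_poly A2) lam mu;
  rewrite ?cp0 ?size_char_poly// ?map_char_poly -?eigenvalue_root_char//.
have LCI := fmorph_inj LC.
have l0 : l != 0 by rewrite -(fmorph_eq0 LC) LCl.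
have m0 : m != 0 by rewrite -(fmorph_eq0 LC) LCm.
have LCz x (k : int) : LC (x ^ k) = LC x ^ k by exact: fmorphXz.
have LCxi a b : LC (l ^ a / m ^ b) = lam ^ a / mu ^ b.
  by rewrite fmorph_div !LCz LCl LCm.
have tors (x : L) k : (0 < k)%N -> x ^+ k = 1 -> x ^+ M = 1.
  exact: (torsion_exponent eps0 gap dimL).
split=> [a b g g0|a b g cab b0 g0].
  rewrite -LCxi -!rmorphXn -(rmorph1 LC) => /LCI /tors h.
  by congr (LC _); apply: h.
rewrite -LCxi -LCl -!rmorphXn -[in X in X -> _](rmorph1 LC) => /LCI xi1.
rewrite -(rmorph1 LC) (inj_eq LCI) => lM.
set xi := l ^ a / m ^ b in xi1.
have [[u w] /= uw] := coprimezP _ _ cab.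
pose gam := l ^ w * m ^ u.
have gamb : gam ^ b = l * xi ^ (- u).
  rewrite /gam /xi !expfzMl invr_expz !exprz_exp mulrA -[X in X * _ * _]expr1z.
  rewrite -expfzDr// mulrNN [b * u]mulrC; congr (l ^ _ * _).
  by rewrite -uw mulrN [a * u]mulrC addrAC subrr add0r.
(* For negative b, the inverse of gam makes the exponent positive. *)
have [x x0 xb] : exists2 x, x != 0 & x ^+ `|b|%N = gam ^ b.
  have gam0 : gam != 0 by rewrite mulf_neq0// expfz_neq0.
  case: b {cab uw gamb xi xi1 LCxi} b0 => k _; first by exists gam.
  by exists gam^-1; rewrite ?invr_eq0// exprVn.
have lx : l ^+ g = x ^+ (`|b|%N * g).
  rewrite exprM xb gamb exprMn (_ : (xi ^ (- u)) ^+ g = 1) ?mulr1//.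
  by rewrite exprnP exprzAC -exprnP xi1 exp1rz.
have xM : x ^+ M != 1.
  apply: contra_neq lM => xM; apply: (tors l (g * M)%N); first by rewrite muln_gt0 g0.
  by rewrite exprM lx -exprM mulnC exprM xM expr1n.
have Al : eigenvalue (map_mx j A1) l.
  rewrite eigenvalue_root_char -map_char_poly -(fmorph_root LC) LCl.
  rewrite -map_poly_comp (eq_map_poly LCj) map_char_poly -eigenvalue_root_char//.
have del0 : 0 <= Num.min eps 1 by rewrite le_min (ltW eps0) ler01.
have h1 := mx_height_ge1 R A1; set h := _ ^+ _ in h1 *.
have B0 : (0 < B)%N by rewrite !muln_gt0 adim_gt0.
have [x_int|x_nint] := pselect (integral_over_int x).
  have [s hs] := large_conjugate gap dimL x0 x_int xM.
  have := integral_bound Al g0 lx s; rewrite -/h => hb.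
  apply: (@le_trans _ _ ((1 + eps) ^+ `|b|%N)).
    apply: lerXn2r; rewrite ?nnegrE ?addr_ge0 ?ler01 ?(ltW eps0)//.
    by rewrite lerD2l ge_min lexx.
  apply: (@le_trans _ _ (ComplexField.Normc.normc (s x) ^+ `|b|%N)).
    by apply: lerXn2r; rewrite ?nnegrE ?addr_ge0 ?ler01 ?normc_ge0 ?(ltW eps0).
  rewrite (le_trans hb)// ler_wpM2l// -[X in X <= _]expr1.
  exact: ler_weXn2l.
have hb := nonintegral_bound R Al g0 lx dimL x_nint; rewrite -/h in hb.
apply: (@le_trans _ _ (2 ^+ `|b|%N)).
  apply: lerXn2r; rewrite ?nnegrE ?addr_ge0 ?ler01 ?ler0n//.
  by rewrite -[leRHS]/(1 + 1) lerD2l ge_min lexx orbT.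
by rewrite (le_trans hb)// ler_peMl ?ler1n// exprn_ge0// (le_trans ler01).
Qed.

End EigenvaluePairs.

(** * Diagonalization, and the passage to logarithms *)

Section Diagonalization.

(** Diagonalizability over a closed field means that the minimal polynomial is
    separable, which does not depend on the embedding. *)
Lemma diagonalizable_any_embedding (K : fieldExtType rat) n (A : 'M[K]_n.+1)
    (iota : {rmorphism K -> algC}) :
  diagonalizable_over_closure A -> diagonalizable (map_mx iota A).
Proof.
move=> [iota0 /diagonalizableP[rs urs mrs]].
have sep : separable_poly (mxminpoly A).
  rewrite -(separable_map iota0) -mxminpoly_map.
  by apply: dvdp_separable mrs _; rewrite separable_prod_XsubC.
have [r rE] := closed_field_poly_normal (mxminpoly (map_mx iota A)).
have mon := mxminpoly_monic (map_mx iota A).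
rewrite (monicP mon) scale1r in rE.
apply/diagonalizableP; exists r; last by rewrite rE.
by rewrite -separable_prod_XsubC -rE mxminpoly_map separable_map.
Qed.

Lemma mulmx_exprz (F : fieldType) n (A : 'M[F]_n.+1) (v : 'rV[F]_n.+1) (a : F) (k : int) :
  A \in unitmx -> a != 0 -> v *m A = a *: v -> v *m A ^ k = a ^ k *: v.
Proof.
move=> Au a0 vA.
have vX m : v *m A ^+ m = a ^+ m *: v.
  elim: m => [|m ih]; first by rewrite mulmx1 scale1r.
  by rewrite exprSr mulmxA ih -scalemxAl vA scalerA exprSr.
case: k => m; first exact: vX.
have Am : A ^+ m.+1 \in unitmx by rewrite unitrX.
rewrite NegzE -!exprnN.
rewrite -[RHS](mulmxK Am) -scalemxAl vX scalerA mulVf ?scale1r//.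
exact: expf_neq0.
Qed.

Lemma diagonalized (n : nat) (A : 'M[algC]_n.+1) : A \in unitmx -> diagonalizable A ->
  exists (P : 'M[algC]_n.+1) (d : 'I_n.+1 -> algC), [/\ P \in unitmx,
    forall i, d i != 0, forall i, eigenvalue A (d i)
    & forall k : int, P *m A ^ k = diag_mx (\row_i d i ^ k) *m P].
Proof.
move=> Au [P Pu /diagonalizable_forPex[D /(simmxLR Pu) AE]].
have PA : P *m A = diag_mx D *m P by rewrite AE mxpoly.conjVmx// !mulmxA mulmxV// mul1mx.
have vA i : row i P *m A = D 0 i *: row i P.
  by rewrite -row_mul PA row_mul row_diag_mx -scalemxAl -rowE.
have v0 i : row i P != 0.
  apply/eqP; rewrite rowE => /(congr1 (mulmx^~ (invmx P))); rewrite mulmxK// mul0mx.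
  by move=> /rowP/(_ i)/eqP; rewrite !mxE !eqxx oner_eq0.
have d0 i : D 0 i != 0.
  apply: contraNneq (v0 i) => d0; have := vA i; rewrite d0 scale0r => h.
  by rewrite -(mulmxK Au (row i P)) h mul0mx.
exists P, (D 0); split=> //.
  by move=> i; apply/eigenvalueP; exists (row i P).
move=> k; apply/row_matrixP => i; rewrite !row_mul (mulmx_exprz _ Au (d0 i) (vA i)).
by rewrite row_diag_mx -scalemxAl -rowE mxE.
Qed.

End Diagonalization.

Section LogBound.
Variable R : realType.

Lemma log_bound (n B d : nat) (c del : R) : 0 < del ->
  exists2 C : R, 0 < C & forall (H h : R) (b : nat), 2 <= H -> 0 <= h -> h <= c * H ->
    1 <= h ^+ d -> (1 + del) ^+ b <= n.+1%:R * (h ^+ d) ^+ B -> b%:R <= C * ln H.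
Proof.
move=> del0; pose c' : R := Num.max 1 c.
have ld : 0 < ln (1 + del) by rewrite ln_gt0// ltrDl.
have l2 : 0 < ln 2 :> R by rewrite ln_gt0// ltr1n.
have c1 : 1 <= c' by rewrite le_max lexx.
pose E : R := (d * B)%:R.
have E0 : 0 <= E by rewrite ler0n.
have lc : 0 <= ln c' by rewrite ln_ge0.
have ln_n : 0 <= ln n.+1%:R :> R by rewrite ln_ge0// ler1n.
pose C : R := (ln n.+1%:R / ln 2 + E * (ln c' / ln 2 + 1)) / ln (1 + del).
have C0 : 0 <= C.
  have l2' := ltW l2; have ld' := ltW ld.
  rewrite divr_ge0// addr_ge0 ?divr_ge0// mulr_ge0// addr_ge0 ?ler01//.
  by rewrite divr_ge0.
exists (C + 1); first by rewrite ltr_wpDl.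
move=> H h b H2 h0 hcH h1 hb.
have H0 : 0 < H by rewrite (lt_le_trans _ H2).
have lH : ln 2 <= ln H by rewrite ler_ln ?posrE.
have cH0 : 0 < c' * H by rewrite mulr_gt0// (lt_le_trans ltr01 c1).
have hb' : (1 + del) ^+ b <= n.+1%:R * (c' * H) ^+ (d * B).
  rewrite (le_trans hb)// -exprM ler_wpM2l//; apply: lerXn2r; rewrite ?nnegrE ?(ltW cH0)//.
  by rewrite (le_trans hcH)// ler_wpM2r ?(ltW H0)// le_max lexx orbT.
have : ln ((1 + del) ^+ b) <= ln (n.+1%:R * (c' * H) ^+ (d * B)).
  by rewrite ler_ln ?posrE ?mulr_gt0 ?exprn_gt0 ?addr_gt0.
rewrite lnXn ?addr_gt0// lnM ?posrE ?exprn_gt0// lnXn// lnM ?posrE ?(lt_le_trans ltr01 c1)//.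
rewrite -[leLHS]mulr_natl -[X in _ <= _ + X]mulr_natl -/E => hln.
have {}hln : b%:R * ln (1 + del) <= (ln n.+1%:R / ln 2 + E * (ln c' / ln 2 + 1)) * ln H.
  apply: (le_trans hln); rewrite mulrDl lerD//.
    by rewrite mulrAC ler_pdivlMr// ler_wpM2l.
  rewrite -mulrA ler_wpM2l// mulrDl mul1r lerD2r.
  by rewrite mulrAC ler_pdivlMr// ler_wpM2l.
apply: (@le_trans _ _ (C * ln H)).
  by rewrite /C mulrAC ler_pdivlMr.
by rewrite ler_wpM2r ?lerDl// (le_trans (ltW l2)).
Qed.

End LogBound.

(** * Powers of matrices in terms of eigenvalues *)

Section MatrixRelations.
Variables (n : nat) (A1 A2 : 'M[algC]_n.+1).
Hypotheses (u1 : A1 \in unitmx) (u2 : A2 \in unitmx).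
Hypotheses (diag1 : diagonalizable A1) (diag2 : diagonalizable A2).

(** If [P1] and [P2] diagonalize [A1] and [A2], then [S] is the support of
    [P1 P2^-1]: conjugation turns an equality of powers into an intertwining
    relation between diagonal matrices, which is tested entry by entry. *)
Lemma power_relation_eigenvalues :
  exists (lam mu : 'I_n.+1 -> algC) (S : 'I_n.+1 -> 'I_n.+1 -> Prop),
    [/\ forall i, lam i != 0 /\ eigenvalue A1 (lam i),
        forall i, mu i != 0 /\ eigenvalue A2 (mu i),
        forall i, exists j, S i j
      & forall k1 k2 : int, A1 ^ k1 = A2 ^ k2 <->
          forall i j, S i j -> lam i ^ k1 = mu j ^ k2].
Proof.
have [P1 [lam [P1u lam0 elam P1A]]] := diagonalized u1 diag1.
have [P2 [mu [P2u mu0 emu P2A]]] := diagonalized u2 diag2.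
have [Q Qu QP] : exists2 Q, Q \in unitmx & P1 = Q *m P2.
  by exists (P1 *m invmx P2); rewrite ?unitmx_mul ?P1u ?unitmx_inv// mulmxKV.
exists lam, mu, (fun i j => Q i j != 0); split=> //.
  move=> i; apply: contrapT => no.
  have Qi : row i Q = 0.
    apply/rowP => j; rewrite !mxE; apply/eqP; apply: contrapT => /negP Qij.
    by apply: no; exists j.
  move: Qi; rewrite rowE => /(congr1 (mulmx^~ (invmx Q))); rewrite mulmxK// mul0mx.
  by move=> /rowP/(_ i)/eqP; rewrite !mxE !eqxx oner_eq0.
move=> k1 k2.
have -> : A1 ^ k1 = A2 ^ k2 <->
    diag_mx (\row_i lam i ^ k1) *m Q = Q *m diag_mx (\row_i mu i ^ k2).
  split=> [A12|DQ].
    have : P1 *m A1 ^ k1 = Q *m (P2 *m A2 ^ k2) by rewrite A12 mulmxA -QP.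
    rewrite P1A P2A {1}QP !mulmxA => /(congr1 (mulmx^~ (invmx P2))).
    by rewrite /= !mulmxK.
  have : P1 *m A1 ^ k1 = P1 *m A2 ^ k2.
    by rewrite P1A QP mulmxA DQ -[RHS]mulmxA P2A mulmxA.
  by move=> /(congr1 (mulmx (invmx P1))); rewrite /= !mulKmx.
split=> [DQ i j Qij|DQ].
  have := congr1 (fun T : 'M_n.+1 => T i j) DQ.
  by rewrite /= mul_diag_mx mul_mx_diag !mxE [RHS]mulrC => /(mulIf Qij).
apply/matrixP => i j; rewrite mul_diag_mx mul_mx_diag !mxE.
have [->|Qij] := eqVneq (Q i j) 0; first by rewrite mulr0 mul0r.
by rewrite (DQ i j)// mulrC.
Qed.

End MatrixRelations.

Lemma mx_height_ge0 (R : realType) (K : fieldExtType rat) n (A : 'M[K]_n) :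
  0 <= mx_height R A.
Proof. exact: powR_ge0. Qed.

Lemma ratio_root_of_unity (F : fieldType) (x y : F) (k1 k2 : int) :
  x != 0 -> y != 0 -> k1 != 0 -> x ^ k1 = y ^ k2 ->
  exists2 g : nat, (0 < g)%N & (x ^ (k1 %/ gcdz k1 k2)%Z / y ^ (k2 %/ gcdz k1 k2)%Z) ^+ g = 1.
Proof.
move=> x0 y0 k10 xy; exists `|gcdz k1 k2|%N.
  by rewrite absz_gt0 gcdz_eq0 negb_and k10.
rewrite exprnP gez0_abs ?/gcdz// expfzMl exprz_inv -invr_expz.
rewrite -/(gcdz k1 k2) !exprz_exp !divzK ?dvdz_gcdl ?dvdz_gcdr// xy mulfV//.
exact: expfz_neq0.
Qed.

Lemma expz_eq1 (F : fieldType) (x : F) (k : int) : x ^ k = 1 -> x ^+ `|k|%N = 1.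
Proof. by case: k => m //; rewrite NegzE -invr_expz => /(canRL (@invrK _)); rewrite invr1. Qed.

(** * Multiplicatively dependent matrices *)

(* The size n >= 1 is written n.+1. *)
Theorem theorem1 (R : realType) (K : fieldExtType rat) (n : nat) (c : R)
    (hc : 0 < c) :
  exists2 C : R, 0 < C &
    forall (H : R) (A1 A2 : 'M[K]_n.+1),
      2 <= H ->
      A1 \in unitmx -> A2 \in unitmx ->
      diagonalizable_over_closure A1 -> diagonalizable_over_closure A2 ->
      mx_height R A1 <= c * H -> mx_height R A2 <= c * H ->
      (exists k1 k2 : int, k1 * k2 != 0 /\ A1 ^ k1 = A2 ^ k2) ->
      exists k1 k2 : int,
        [/\ k1 * k2 != 0, `|k1|%:~R <= C * ln H, `|k2|%:~R <= C * ln H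
          & A1 ^ k1 = A2 ^ k2].
Proof.
have [M [B [del [M0 del0 pairs]]]] := eigenvalue_pairs R K n.
have [C C0 hC] := log_bound n B (\dim {:K}) c del0.
have l2 : 0 < ln 2 :> R by rewrite ln_gt0// ltr1n.
exists (M%:R * (C + (ln 2)^-1)).
  by rewrite mulr_gt0 ?ltr0n// addr_gt0// invr_gt0.
move=> H A1 A2 H2 u1 u2 d1 d2 h1 h2 [k1 [k2 [k12 A12]]].
have lH : ln 2 <= ln H by rewrite ler_ln ?posrE// (lt_le_trans _ H2).
move: (k12); rewrite mulf_eq0 negb_or => /andP[k10 k20].
case: (d1) => iota _.
have u1' : map_mx iota A1 \in unitmx by rewrite map_unitmx.
have u2' : map_mx iota A2 \in unitmx by rewrite map_unitmx.
have [lam [mu [S [hlam hmu S_ex relE]]]] := power_relation_eigenvalues u1' u2'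
  (diagonalizable_any_embedding iota d1) (diagonalizable_any_embedding iota d2).
have {}relE k k' : A1 ^ k = A2 ^ k' <-> forall i j, S i j -> lam i ^ k = mu j ^ k'.
  apply: iff_trans (relE k k'); rewrite -!rmorphXz//; split=> [->//|].
  exact: map_mx_inj.
have pair12 i j := pairs iota A1 A2 _ _ (hlam i).1 (hmu j).1 (hlam i).2 (hmu j).2.
have pair21 i j := pairs iota A2 A1 _ _ (hmu j).1 (hlam i).1 (hmu j).2 (hlam i).2.
have tor_lam (i j : 'I_n.+1) k : (0 < k)%N -> lam i ^+ k = 1 -> lam i ^+ M = 1.
  by have [/(_ 1 0 k) + _] := pair12 i j; rewrite expr0z divr1.
have tor_mu (i j : 'I_n.+1) k : (0 < k)%N -> mu j ^+ k = 1 -> mu j ^+ M = 1.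
  by have [/(_ 1 0 k) + _] := pair21 i j; rewrite expr0z divr1.
have A12S := (relE _ _).1 A12.
have bound a : `|a|%:~R <= C * ln H ->
    `|a * M%:Z|%:~R <= M%:R * (C + (ln 2)^-1) * ln H.
  move=> ha; rewrite normrM (@ger0_norm _ M%:Z)// intrM -pmulrn mulrC -mulrA ler_wpM2l//.
  by rewrite mulrDl (le_trans ha)// lerDl mulr_ge0// ?invr_ge0 ltW// (lt_le_trans l2).
have one_le : 1 <= (ln 2)^-1 * ln H by rewrite mulrC ler_pdivlMr ?mul1r.
(* All lam i are roots of unity, and then so are the mu j related to them. *)
have [tors|] := pselect (forall i, lam i ^+ M = 1).
  have bM : `|M%:Z|%:~R <= M%:R * (C + (ln 2)^-1) * ln H.
    rewrite ger0_norm// -pmulrn -mulrA ler_peMr// mulrDl (le_trans one_le)// lerDr.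
    by rewrite mulr_ge0 ?ltW// (lt_le_trans l2).
  exists M%:Z, M%:Z; split=> //; first by rewrite mulf_neq0// -lt0n.
  apply/relE => i j Sij; rewrite -!exprnP tors.
  rewrite (tor_mu i j (`|k2| * M)%N) ?muln_gt0 ?absz_gt0 ?k20//.
  rewrite -[M in (_ * M)%N]absz_nat -abszM; apply: expz_eq1.
  by rewrite -exprz_exp -(A12S i j Sij) exprzAC -exprnP tors exp1rz.
move=> /existsNP[i0 /eqP lamM]; have [j0 S0] := S_ex i0.
have muM : mu j0 ^+ M != 1.
  apply: contra_neq lamM => muM; apply: (tor_lam i0 j0 (`|k1| * M)%N).
    by rewrite muln_gt0 absz_gt0 k10.
  rewrite -[M in (_ * M)%N]absz_nat -abszM; apply: expz_eq1.
  by rewrite -exprz_exp (A12S i0 j0 S0) exprzAC -exprnP muM exp1rz.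
(* Any valid exponents are proportional to k1 and k2, so the reduced pair a, b,
   multiplied by M to kill the remaining roots of unity, is the one to try. *)
pose g := gcdz k1 k2; pose a := (k1 %/ g)%Z; pose b := (k2 %/ g)%Z.
have g_neq0 : g != 0 by rewrite gcdz_eq0 negb_and k10.
have aE : k1 = a * g by rewrite divzK// dvdz_gcdl.
have bE : k2 = b * g by rewrite divzK// dvdz_gcdr.
have a0 : a != 0 by apply: contra_neq k10 => a0; rewrite aE a0 mul0r.
have b0 : b != 0 by apply: contra_neq k20 => b0; rewrite bE b0 mul0r.
have cab : coprimez a b.
  rewrite /coprimez -(inj_eq (mulIf g_neq0)) mul1r.
  have g0 : 0 <= g by [].
  by rewrite -{1}(gez0_abs g0) mulz_gcdl -aE -bE.
have ratio i j : S i j -> exists2 e : nat, (0 < e)%N & (lam i ^ a / mu j ^ b) ^+ e = 1.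
  by move=> Sij; apply: ratio_root_of_unity (A12S i j Sij); rewrite ?(hlam i).1 ?(hmu j).1.
have [e e0 lme] := ratio i0 j0 S0.
have mle : (mu j0 ^ b / lam i0 ^ a) ^+ e = 1 by rewrite -invf_div exprVn lme invr1.
(* A single pair of eigenvalues that are not roots of unity bounds both a and b,
   the two matrices playing symmetric parts. *)
have ln_abs (k : int) : (`|k|%N)%:R <= C * ln H -> `|k|%:~R <= C * ln H.
  by rewrite -abszE -pmulrn.
exists (a * M%:Z), (b * M%:Z); split.
- by rewrite !mulf_neq0// -lt0n.
- apply/bound/ln_abs/(hC H (mx_height R A2)) => //; rewrite ?mx_height_ge0 ?mx_height_ge1//.
  by have [_ /(_ b a e)] := pair21 i0 j0; apply => //; rewrite coprimez_sym.
- apply/bound/ln_abs/(hC H (mx_height R A1)) => //; rewrite ?mx_height_ge0 ?mx_height_ge1//.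
  by have [_ /(_ a b e)] := pair12 i0 j0; apply.
apply/relE => i j /ratio[e' e'0 h].
have [/(_ _ _ _ e'0 h) + _] := pair12 i j.
rewrite expr_div_n !exprnP -!exprz_exp => /divr1_eq; exact.
Qed.
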